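(* Let $A=K[x_1,\dots,x_n]/(x_1^{d_1},\dots,x_n^{d_n})$, where $n\ge 1$, all $d_i\ge 2$ are integers and $K$ is a field of characteristic $p>0$. Write each $d_i$ in base $p$ as $d_i=c_{ik_i}p^{k_i}+\dots+c_{i1}p+c_{i0}$, with $0\le c_{ij}<p$ and $c_{ik_i}\neq 0$. The algebra $A$ has the strong Lefschetz property if and only if one of the following conditions holds: 1. $n=1$; 2. $n=2$, $p=2$, and, with the variables ordered so that $d_1\le d_2$, one of the following holds: - $d_1=2$ and $c_{20}=1$; - $d_1=3$, $c_{21}=1$, and $c_{20}=0$; 3. $n=2$, $p>2$, and, with the variables ordered so that $k_1\le k_2$, all of the following are satisfied: - $c_{10}\in\{\frac{p-1}{2},\frac{p+1}{2}\}$ and $c_{20}\in\{\frac{p-1}{2},\frac{p+1}{2}\}$ (independently); - $c_{1j}=c_{2j}=\frac{p-1}{2}$ for $j=1,\dots,k_1-1$; - $c_{1k_1}+c_{2k_1}<p$, and $c_{2k_1}\ge c_{1k_1}$ if $k_1<k_2$; 4. $n\ge 2$ and $\sum_{i=1}^n(d_i-1)<p$; 5. $n\ge 2$ and there is a $j$ such that $d_j\ge p$, $d_i<p$ for all $i\neq j$, and $\sum_{i\neq j}(d_i-1)\le\min(c_{j0},p-c_{j0})$.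
   Context: Polynomial rings carry the standard grading, and quotients by homogeneous ideals the induced grading $A=\bigoplus_{i\ge 0}A_i$. A linear map is said to have maximal rank if it is injective or surjective. A graded algebra $A$ has the strong Lefschetz property if there exists $\ell\in A_1$ such that the multiplication maps $\cdot\ell^m:A_i\to A_{i+m}$ have maximal rank for all $i\ge 0$ and all $m\ge 1$. *)

(* Defs.v *)
From HB Require Import structures.
From mathcomp Require Import all_boot all_algebra.
From mathcomp Require Import boolp.
From mathcomp Require Import mpoly.

Set Implicit Arguments.
Unset Strict Implicit.
Unset Printing Implicit Defensive.

Import GRing.Theory.
Local Open Scope ring_scope.
Local Open Scope quotient_scope.

Section PowerIdeal.

Variables (K : fieldType) (n : nat) (d : 'I_n -> nat).
Hypothesis hd : forall i, (2 <= d i)%N.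

Definition in_power_ideal (f : {mpoly K[n]}) : Prop :=
  exists g : 'I_n -> {mpoly K[n]}, f = \sum_(i < n) g i * 'X_i ^+ d i.

(* The library quotients by boolean predicates that exclude 1, hence the
   classical reflection and the argument hd. *)
Definition power_ideal (_ : forall i, (2 <= d i)%N) : {pred {mpoly K[n]}} :=
  fun f => `[< in_power_ideal f >].

Lemma power_idealP f : reflect (in_power_ideal f) (f \in power_ideal hd).
Proof. exact: asboolP. Qed.

Lemma power_ideal_closed : idealr_closed (power_ideal hd).
Proof.
split.
- apply/power_idealP; exists (fun=> 0).
  by rewrite big1 // => i _; rewrite mul0r.
- apply/power_idealP => -[g /(congr1 (mmap idfun (fun=> 0)))].
  rewrite rmorph1 rmorph_sum big1 => [/eqP|i _]; first by rewrite oner_eq0.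
  rewrite rmorphM rmorphXn /= mmapX mmap1U expr0n.
  by rewrite -leqn0 leqNgt (ltnW (hd i)) mulr0.
- move=> a u v /power_idealP[g ->] /power_idealP[h ->].
  apply/power_idealP; exists (fun i => a * g i + h i).
  rewrite mulr_sumr -big_split; apply: eq_bigr => i _.
  by rewrite mulrDl mulrA.
Qed.

HB.instance Definition _ :=
  isIdealr.Build {mpoly K[n]} (power_ideal hd) power_ideal_closed.

Definition monomial_ci : comNzRingType := {ideal_quot (power_ideal hd)}.

Definition monomial_ci_graded (i : nat) (a : monomial_ci) : Prop :=
  exists2 f : {mpoly K[n]},
    f \is i.-homog & a = \pi_{ideal_quot (power_ideal hd)} f.

End PowerIdeal.

(* f restricts to an injection of U or maps U onto V. *)
Definition maximal_rank (A : Type) (U V : A -> Prop) (f : A -> A) : Prop :=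
  (forall x y, U x -> U y -> f x = f y -> x = y) \/
  (forall z, V z -> exists2 x, U x & f x = z).

Definition strong_lefschetz (A : comNzRingType) (A_ : nat -> A -> Prop) : Prop :=
  exists2 l : A, A_ 1%N l &
    forall i m : nat, (1 <= m)%N ->
      maximal_rank (A_ i) (A_ (i + m)%N) (fun x => l ^+ m * x).

Definition base_expansion (p d k : nat) (c : nat -> nat) : Prop :=
  [/\ (forall j, j <= k -> c j < p)%N, c k != 0%N
    & d = (\sum_(j < k.+1) c j * p ^ j)%N].

(* Main.v *)
Require Import Defs.
From mathcomp Require Import all_boot all_algebra.
From HB Require Import structures.
From mathcomp Require Import mpoly zify ring.

(* Write D for the socle degree, the sum of the d_i - 1. Monomials of complementary degrees
   pair perfectly, so the strong Lefschetz property says that some linear form l is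
   "centred": l^(D-2i) is injective on A_i whenever 2i <= D.

   In two variables of exponents a and b, l^(a+b-2r) on A_(r-1) has, in the basis
   l^s y^(r-1-s), the matrix with entries C(a+b-2r+s, a-r+t). Its determinant is the
   number of plane partitions in an r x (a-r) x (b-r) box. By Legendre's formula its
   p-adic valuation is a sum over q = p^e of nonnegative terms depending only on the residues
   of r, a and b modulo q, and the vanishing of all of them is a condition on base-p digits.

   Necessity for more variables: if v of degree g satisfies z^a v = 0 and y^b v = 0, where
   l = z + y + w and the degrees are centred around D/2, then v spans a copy of the
   two-variable algebra with exponents a and b, so (a, b) satisfies the two-variable
   condition. Taking v = 1 bounds the sums of the d_i - 1. If p is odd, two
   exponents are at least p and there is a third one, some v killed by (x_1 + x_2)^a with
   p | a yields a pair (a, b), which is impossible. For p = 2 the members of every pair have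
   opposite parities, so there are at most two variables.

   Sufficiency for more variables: if D < p, the lowering operator of the sl_2-action
   is available. If d_j >= p is the only large exponent, l^p = x_j^p reduces the problem to
   the exponent d_j mod p in degrees at most the socle degree of the other variables, and
   every element of larger degree is a multiple of l. *)

Set Implicit Arguments.
Unset Strict Implicit.
Unset Printing Implicit Defensive.

Import GRing.Theory.

(** * Residue conditions for pairs of exponents *)

Local Open Scope nat_scope.

(* MacMahon's number of plane partitions in an r x s x t box, as a product of
   q-integers, contains the cyclotomic factor of index q exactly when this fails. *)
Definition good (q r s t : nat) : bool :=
  [|| r %% q == 0, s %% q == 0, t %% q == 0,
      r %% q + s %% q + t %% q <= q | 2 * q <= r %% q + s %% q + t %% q].

Lemma modn_subn (x r q : nat) : r <= x -> r < q ->
  (x - r) %% q = if r <= x %% q then x %% q - r else x %% q + q - r.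
Proof.
move=> hrx hrq; have q0 : 0 < q by lia.
have hx := ltn_pmod x q0.
have ex := divn_eq x q.
case: ifP => h.
- have -> : x - r = x %/ q * q + (x %% q - r) by lia.
  by rewrite modnMDl modn_small //; lia.
- have hk : 0 < x %/ q by case: (x %/ q) ex => [|k] //; lia.
  have -> : x - r = (x %/ q).-1 * q + (x %% q + q - r) by case: (x %/ q) ex hk => [|k] //=; nia.
  by rewrite modnMDl modn_small //; lia.
Qed.

(** Removes the remainders of a - r and b - r, leaving linear arithmetic in a mod q and b mod q. As
    0 < r < q, only the residues of a - r and b - r can vanish, which gives the first two cases. *)
Lemma good_lift (q a b r : nat) : 0 < r < q -> r <= a -> r <= b ->
  good q r (a - r) (b - r) ->
  [\/ r = a %% q, r = b %% q,
     r + (if r <= a %% q then a %% q - r else a %% q + q - r) +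
       (if r <= b %% q then b %% q - r else b %% q + q - r) <= q |
     2 * q <= r + (if r <= a %% q then a %% q - r else a %% q + q - r) +
       (if r <= b %% q then b %% q - r else b %% q + q - r)].
Proof.
move=> hr ra rb; have q0 : 0 < q by lia.
have ha := ltn_pmod a q0; have hb := ltn_pmod b q0.
rewrite /good (modn_small (m := r)) ?modn_subn; try lia.
case/or4P => [/eqP|/eqP|/eqP|/orP[|]] h.
- lia.
- by constructor 1; move: h; case: ifP; lia.
- by constructor 2; move: h; case: ifP; lia.
- by constructor 3.
- by constructor 4.
Qed.

(* Only r = 1, 2, q - 1 and x + 1 matter. *)
Lemma residues_odd (h x y : nat) (q := (2 * h).+1) : 0 < h -> x < q -> y < q ->
  x <= y ->
  (forall r, 0 < r < q ->
    [\/ r = x, r = y,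
     r + (if r <= x then x - r else x + q - r) +
       (if r <= y then y - r else y + q - r) <= q |
     2 * q <= r + (if r <= x then x - r else x + q - r) +
       (if r <= y then y - r else y + q - r)]) ->
  (x = h \/ x = h.+1) /\ (y = h \/ y = h.+1).
Proof.
move=> h0 hx hy xy H.
(* Three ranges of r: below both residues, between them, above both. Each wrap-around adds q to the
   sum of the three residues. *)
have H1 r : 0 < r < x -> x + y - r <= q \/ 2 * q <= x + y - r.
  move=> hr; have := H r; rewrite !ifT; try lia.
  by case; lia.
have H2 r : x < r < y -> 0 < r -> x + y + q - r <= q \/ 2 * q <= x + y + q - r.
  move=> hr r0; have := H r; rewrite ifF ?ifT; try lia.
  by case; lia.
have H3 r : y < r < q -> 2 * q <= x + y + 2 * q - r.
  move=> hr; have := H r; rewrite !ifF; try lia.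
  by case; lia.
clear H; have h1 := H1 1; have h2 := H2 x.+1; have h3 := H3 (2 * h).
have h4 := H3 2; clear H1 H2 H3; rewrite /q in h1 h2 h3 h4 hx hy *.
lia.
Qed.

(** For prime p: no plane-partition number of an r x (a-r) x (b-r) box is divisible by p. At r =
    min(a, b) the box has an empty side, so only smaller r are constrained. *)
Definition pair_good (p a b : nat) : Prop :=
  forall e r, 0 < e -> 0 < r < minn a b -> good (p ^ e) r (a - r) (b - r).

Lemma goodC q r s t : good q r s t = good q r t s.
Proof. by rewrite /good addnAC; case: (s %% q == 0); case: (t %% q == 0). Qed.

Lemma pair_goodC p a b : pair_good p a b -> pair_good p b a.
Proof. by move=> h e r he hr; rewrite goodC; apply: h; rewrite // minnC. Qed.

Definition half_residue (q a : nat) : Prop := a %% q = q./2 \/ a %% q = q./2.+1.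

Lemma good_half_residues q a b : odd q -> 3 <= q -> q <= a -> q <= b ->
  (forall r, 0 < r < q -> r < a -> r < b -> good q r (a - r) (b - r)) ->
  half_residue q a /\ half_residue q b.
Proof.
wlog xy : a b / a %% q <= b %% q => [W|] oq q3 qa qb H.
  case: (leqP (a %% q) (b %% q)) => h; first exact: W.
  suff [? ?] : half_residue q b /\ half_residue q a by [].
  apply: W => //; first exact: ltnW.
  by move=> r ? ? ?; rewrite goodC; apply: H.
have q0 : 0 < q by lia.
have eq : q = (2 * q./2).+1 by lia.
have h0 : 0 < q./2 by lia.
have := @residues_odd q./2 (a %% q) (b %% q) h0.
rewrite -eq /half_residue => /(_ (ltn_pmod _ q0) (ltn_pmod _ q0) xy); apply.
by move=> r hr; apply: good_lift; [| | |apply: H]; lia.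
Qed.

Lemma pair_good_half_residues p e a b : odd p -> 3 <= p -> 0 < e ->
  p ^ e <= minn a b -> pair_good p a b ->
  half_residue (p ^ e) a /\ half_residue (p ^ e) b.
Proof.
move=> op p3 e0 hq h.
have q3 : 3 <= p ^ e by apply: leq_trans p3 _; rewrite -{1}[p]expn1 leq_pexp2l //; lia.
apply: good_half_residues; rewrite ?oddX ?op ?orbT //; try lia.
by move=> r ? ? ?; apply: h; lia.
Qed.

Lemma pair_good_small p a b : 1 < p -> 1 < a <= p -> 1 < b <= p ->
  pair_good p a b -> a + b - 2 < p.
Proof.
move=> p1 ha hb h; have := h 1 1; rewrite expn1 /good !modn_small; lia.
Qed.

(** If b mod p < a - 1, then r = b mod p + 1 fails, since b - r has residue p - 1 and the sum of
    residues is a + p - 1. Otherwise r = 1 bounds a - 1 + b mod p by p. *)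
Lemma pair_good_mixed p a b : 1 < p -> 1 < a <= p -> a <= b ->
  pair_good p a b -> a - 1 <= minn (b %% p) (p - b %% p).
Proof.
move=> p1 ha ab h; have p0 : 0 < p by lia.
have hb := ltn_pmod b p0.
have h1 := h 1 1; have h2 := h 1 (b %% p).+1.
case: (leqP (b %% p).+1 (a - 1)) => hc.
- have := h 1 (b %% p).+1 isT; rewrite expn1 => H.
  have {H} : good p (b %% p).+1 (a - (b %% p).+1) (b - (b %% p).+1) by apply: H; lia.
  rewrite /good (@modn_subn b) ?ltnn ?(modn_small (m := a - _)) ?(modn_small (m := (b %% p).+1)); try lia.
- case: (posnP (b %% p)) => b0; first by lia.
  have := h 1 1 isT; rewrite expn1 => H.
  have {H} : good p 1 (a - 1) (b - 1) by apply: H; lia.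
  rewrite /good (@modn_subn b) ?b0 ?(modn_small (m := a - _)) ?(modn_small (m := 1)); lia.
Qed.

(** For 0 < r < p the residues of r and a - r add up to p, so goodness modulo p forces r = b mod p.
    This cannot hold for both r = 1 and r = 2, and if 1 < b < p it fails already for r = 1. *)
Lemma dvdn_not_pair_good p a b : 2 < p -> p %| a -> 0 < a -> 1 < b ->
  ~ pair_good p a b.
Proof.
move=> p2 pa a0 b1 h; have pla := dvdn_leq a0 pa.
have am : a %% p = 0 by apply/eqP.
have p0 : 0 < p by lia.
have hb := ltn_pmod b p0.
have H r : 0 < r < 3 -> r < b -> good p r (a - r) (b - r).
  by move=> hr rb; have := h 1 r isT; rewrite expn1; apply; lia.
have {h H} h2 r : 0 < r < 3 -> r < b -> [|| b %% p == r,
    p + (if r <= b %% p then b %% p - r else b %% p + p - r) <= p |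
    2 * p <= p + (if r <= b %% p then b %% p - r else b %% p + p - r)].
  move=> hr rb; have := H r hr rb; rewrite /good (@modn_subn a) ?(@modn_subn b); try lia; rewrite am.
  rewrite (modn_small (m := r)); last by lia.
  rewrite ifF; last by lia.
  move: hb; generalize (b %% p) => n hn.
  by case: ifP => hrn /or4P[|||/orP[]]; lia.
have := h2 1 isT b1; have := h2 2 isT; move: hb.
case: (ltnP b p) => hbp; first rewrite (modn_small hbp).
  by move=> _ _; rewrite ifT; [case/or3P|]; lia.
have {}hbp : 2 < b by lia.
move: (b %% p) => n hn /(_ hbp).
by do 2!case: ifP => ?; case/or3P=> ?; case/or3P=> ?; lia.
Qed.

(** * Base-p digits and half residues, p odd *)

Lemma modn_mulS q p d : d %% (q * p) = (d %/ q %% p) * q + d %% q.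
Proof.
rewrite modn_divl mulnC -(@modn_dvdm (q * p) d q) ?dvdn_mulr // mulnC.
by rewrite [_ * q]mulnC [q * (_ %/ _)]mulnC -divn_eq mulnC.
Qed.

Lemma digit_sum_lt p c m : (forall j, j < m -> c j < p) ->
  \sum_(j < m) c j * p ^ j < p ^ m.
Proof.
elim: m => [|m IH] h; first by rewrite big_ord0.
rewrite big_ord_recr /= expnS.
have /IH : forall j, j < m -> c j < p by move=> j hj; apply: h; lia.
move=> hS; have : (c m).+1 * p ^ m <= p * p ^ m by rewrite leq_mul2r h ?orbT.
by apply: leq_trans; rewrite mulSn ltn_add2r.
Qed.

Lemma digit_sum_split p (c : nat -> nat) m n : m <= n ->
  exists X, \sum_(j < n) c j * p ^ j = \sum_(j < m) c j * p ^ j + X * p ^ m.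
Proof.
move=> /subnKC <-; elim: (n - m) => [|t [X IH]]; first by exists 0; rewrite addn0 mul0n addn0.
exists (X + c (m + t) * p ^ t); rewrite addnS big_ord_recr /= IH expnD.
by rewrite mulnDl addnA mulnA mulnAC.
Qed.

Lemma base_expansion_digit p d k c : base_expansion p d k c ->
  forall j, j <= k -> d %/ p ^ j %% p = c j.
Proof.
case=> hc _ -> j jk; have p0 : 0 < p by have := hc 0 isT; lia.
have [X ->] := @digit_sum_split p c j.+1 k.+1 jk.
rewrite big_ord_recr /= expnS mulnA addnAC -addnA addnC -mulnDl divnMDl ?expn_gt0 ?p0 //.
rewrite divn_small ?addn0 ?modnMDl ?modn_small ?hc //.
by apply: digit_sum_lt => i ij; apply: hc; lia.
Qed.

Lemma base_expansion_top p d k c : base_expansion p d k c ->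
  [/\ d %/ p ^ k = c k, p ^ k <= d & d < p ^ k.+1].
Proof.
case=> hc c0 ->; have p0 : 0 < p by have := hc 0 isT; lia.
have hlt : \sum_(j < k) c j * p ^ j < p ^ k.
  by apply: digit_sum_lt => i ij; apply: hc; lia.
have hck := hc k (leqnn _).
split; last by apply: digit_sum_lt => j hj; apply: hc; lia.
  by rewrite big_ord_recr /= addnC divnMDl ?expn_gt0 ?p0 // divn_small ?addn0.
by rewrite big_ord_recr /= (leq_trans _ (leq_addl _ _)) // leq_pmull // lt0n.
Qed.

(** All base-p digits of (p^e - 1)/2 are (p - 1)/2; this is the recursion behind the middle digits
    of the classification. *)
Lemma half_expS p e : odd p -> 0 < e -> (p ^ e.+1)./2 = p./2 * p ^ e + (p ^ e)./2.
Proof.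
move=> op _; have oe : odd (p ^ e) by rewrite oddX op orbT.
have := odd_double_half p; have := odd_double_half (p ^ e); have := odd_double_half (p ^ e.+1).
rewrite oddX op orbT oe expnS; nia.
Qed.

(** d mod p^(j+1) is digit j times p^j plus d mod p^j. If both residues are half residues, digit j
    has to be (p - 1)/2, because (p^j + 1)/2 < p^j. Only digit 0 keeps two choices. *)
Lemma half_residues_digits p m d : odd p -> 2 < p -> 0 < m ->
  (forall e, 0 < e <= m -> half_residue (p ^ e) d) <->
  half_residue p d /\ (forall j, 0 < j < m -> d %/ p ^ j %% p = p./2).
Proof.
move=> op p2 m0.
have big e : 0 < e -> 3 <= p ^ e.
  by move=> e0; apply: leq_trans p2 _; rewrite -{1}[p]expn1 leq_pexp2l //; lia.
have oddp e : odd (p ^ e) by rewrite oddX op orbT.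
split=> [h|[h0 hj] e /andP[e0 em]].
- split=> [|j /andP[j0 jm]]; first by have := h 1; rewrite expn1; apply; lia.
  have h1 := h j ltac:(lia); have h2 := h j.+1 ltac:(lia).
  move: h1 h2; rewrite /half_residue half_expS // expnS mulnC modn_mulS.
  have := big j j0; have := oddp j; set D := _ %/ _ %% _ => od b3.
  move: (p ^ j) od b3 => q od b3 h1 h2.
  case: (ltngtP D p./2) => // hD.
    have : D.+1 * q <= p./2 * q by rewrite leq_mul2r hD orbT.
    by lia.
  have : p./2.+1 * q <= D * q by rewrite leq_mul2r hD orbT.
  by lia.
- elim: e e0 em => // -[|e] IH _ em; first by rewrite expn1.
  have := IH isT (ltnW em); rewrite /half_residue (@half_expS p e.+1) //.
  rewrite (expnS p e.+1) [p * _]mulnC modn_mulS.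
  by rewrite hj ?em //; lia.
Qed.

(** Nothing wraps around: r <= a - 1 <= b mod q, so the residues are r, a - r and b mod q - r, with
    sum a + b mod q - r <= q. *)
Lemma goodT_core q a b : 1 < q -> a - 1 <= b %% q -> a - 1 + b %% q <= q ->
  forall r, 0 < r < minn a b -> good q r (a - r) (b - r).
Proof.
move=> q1 h1 h2 r hr; have hb : b %% q < q by apply: ltn_pmod; lia.
rewrite /good (@modn_subn b) ?ifT ?(modn_small (m := r)) ?(modn_small (m := a - r)); lia.
Qed.

(** One may take r < q. With x and y the residues of a and b, the sum is x + y - r <= q for r below
    both, and x + y + 2q - r >= 2q for r above both. If r exceeds only one of them, then r equals
    the other and a residue vanishes. *)
Lemma goodT_half q a b r : odd q -> 2 < q -> half_residue q a -> half_residue q b ->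
  r <= a -> r <= b -> good q r (a - r) (b - r).
Proof.
move=> oq q2 ha hb ra rb; have q0 : 0 < q by lia.
wlog rq : r a b ra rb ha hb / r < q => [W|].
  have er := divn_eq r q.
  have e x : r <= x -> (x - r) %% q = ((x - r %/ q * q) - r %% q) %% q.
    by move=> rx; rewrite -subnDA -er.
  have f x : r <= x -> (x - r %/ q * q) %% q = x %% q.
    move=> rx; have -> : x = r %/ q * q + (x - r %/ q * q) by lia.
    by rewrite addKn modnMDl.
  have := W (r %% q) (a - r %/ q * q) (b - r %/ q * q).
  rewrite /good /half_residue -!e // !f // modn_mod; apply=> //; try lia.
case: (posnP r) => [->|r0]; first by rewrite /good mod0n.
rewrite /good (@modn_subn a) ?(@modn_subn b) ?(modn_small (m := r)) //.
move: ha hb; rewrite /half_residue.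
have : (q./2 * 2).+1 = q by lia.
move: (a %% q) (b %% q) (q./2) => x y h hq hx hy.
case: ifP => ?; case: ifP => ?; case: hx => hx; case: hy => hy; lia.
Qed.

(** Both the residue of b and its complement to the modulus grow with the power of p, so the
    hypotheses of [goodT_core] pass from p^j to every higher power. *)
Lemma modn_exp_bounds p e j b : 1 < p -> j <= e ->
  b %% p ^ j <= b %% p ^ e /\ b %% p ^ e + p ^ j <= p ^ e + b %% p ^ j.
Proof.
move=> p1 je; have dv : p ^ j %| p ^ e by rewrite dvdn_exp2l.
rewrite -(modn_dvdm _ dv); have p0 : 0 < p ^ e by rewrite expn_gt0; lia.
have pj : 0 < p ^ j by rewrite expn_gt0; lia.
have := ltn_pmod b p0; move: (b %% p ^ e) => x hx.
split; first by rewrite leq_mod.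
case/dvdnP: dv => t et; rewrite {p0}et in hx *.
have := divn_eq x (p ^ j); have := ltn_pmod x pj.
move: (p ^ j) hx pj => w hx pj; move: (x %/ w) (x %% w) => u v hv exx.
have ut : u < t.
  rewrite ltnNge; apply/negP => tu; have : t * w <= u * w by rewrite leq_mul2r tu orbT.
  by lia.
have : u.+1 * w <= t * w by rewrite leq_mul2r ut orbT.
by rewrite mulSn; lia.
Qed.

Lemma pair_good_of_sum p a b : 1 < p -> 1 < a -> 1 < b -> a + b - 2 < p ->
  pair_good p a b.
Proof.
move=> p1; wlog ab : a b / a <= b => [W|] a1 b1 s.
  case: (leqP a b) => h; first exact: W.
  by apply: pair_goodC; apply: W; rewrite // 1?addnC // ltnW.
move=> e r e0; have q1 : p <= p ^ e by rewrite -{1}[p]expn1 leq_pexp2l //; lia.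
by apply: goodT_core; rewrite ?modn_small; lia.
Qed.

Lemma pair_good_of_residue p a b : 1 < p ->
  a - 1 <= minn (b %% p) (p - b %% p) -> pair_good p a b.
Proof.
move=> p1 h e r e0; have q1 : p <= p ^ e by rewrite -{1}[p]expn1 leq_pexp2l //; lia.
have := @modn_exp_bounds p e 1 b p1 e0; rewrite expn1 => h2.
by apply: goodT_core; lia.
Qed.

(** Supplies the hypotheses of [goodT_core] at p^(k+1): the parts of a and b below p^k sum to at
    most p^k + 1 and differ by at most 1, so the digits at p^k decide. *)
Lemma half_residues_sum p k a b : odd p -> 2 < p -> 0 < k ->
  half_residue (p ^ k) a /\ half_residue (p ^ k) b ->
  a %/ p ^ k + b %/ p ^ k %% p < p ->
  a + b %% p ^ k.+1 <= p ^ k.+1 + 1 /\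
  (a %/ p ^ k <= b %/ p ^ k %% p -> a - 1 <= b %% p ^ k.+1).
Proof.
move=> op p2 k0 []; rewrite /half_residue => ha hb hs.
have eq : (p ^ k)./2.*2.+1 = p ^ k by rewrite -[RHS]odd_double_half oddX op orbT.
have hm : (a %/ p ^ k + b %/ p ^ k %% p).+1 * p ^ k <= p * p ^ k.
  by rewrite leq_mul2r hs orbT.
rewrite mulSn mulnDl in hm.
have ea := divn_eq a (p ^ k); rewrite {1 3}ea expnSr modn_mulS.
have hm2 : a %/ p ^ k <= b %/ p ^ k %% p -> a %/ p ^ k * p ^ k <= b %/ p ^ k %% p * p ^ k.
  by move=> h; rewrite leq_mul2r h orbT.
rewrite [p ^ k * p]mulnC.
move: (p * p ^ k) hm => Q hm.
move: (_ * p ^ k) (_ * p ^ k) ha hb hm hm2 eq.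
move: (a %% p ^ k) (b %% p ^ k) (p ^ k)./2 => x y h.
clear hs ea; move: (p ^ k) (_ <= _) => q c; lia.
Qed.

(** Powers up to p^k are covered by the half residues, higher ones by [goodT_core]. If b < p^(k+1),
    the roles of a and b may have to be exchanged there. *)
Lemma pair_good_of_digits p k a b : odd p -> 2 < p ->
  p ^ k <= a < p ^ k.+1 -> p ^ k <= b -> 0 < k ->
  (forall e, 0 < e <= k -> half_residue (p ^ e) a /\ half_residue (p ^ e) b) ->
  a %/ p ^ k + b %/ p ^ k %% p < p ->
  (p ^ k.+1 <= b -> a %/ p ^ k <= b %/ p ^ k %% p) ->
  pair_good p a b.
Proof.
move=> op p2 ha hb k0 hh hs ht e r e0 hr.
have p1 : 1 < p by lia.
have q3 : 2 < p ^ k by apply: leq_trans p2 _; rewrite -{1}[p]expn1 leq_pexp2l //; lia.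
have q3e : 2 < p ^ e by apply: leq_trans p2 _; rewrite -{1}[p]expn1 leq_pexp2l //; lia.
case: (leqP e k) => ek.
  have [h1 h2] := hh e ltac:(lia).
  by apply: goodT_half; rewrite ?oddX ?op ?orbT //; lia.
have [mb1 mb2] := @modn_exp_bounds p e k.+1 b p1 ek.
have eQ : p ^ k.+1 = p * p ^ k by rewrite expnS.
have le : p ^ k.+1 <= p ^ e by rewrite leq_pexp2l // ltnW.
have [key1 key2] := half_residues_sum op p2 k0 (hh k ltac:(lia)) hs.
case: (ltnP b (p ^ k.+1)) => hbQ.
  rewrite modn_small // in key1.
  move: (p ^ k.+1) (p ^ e) eQ le key1 hbQ q3e {ha hb hs ht key2 mb1 mb2 q3} => Q q _ le key1 hbQ q3e.
  case: (leqP a b) => ab.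
    by apply: goodT_core => //; rewrite ?modn_small; lia.
  by rewrite goodC; apply: goodT_core => //; rewrite ?modn_small; lia.
have {}key2 := key2 (ht hbQ).
move: (b %% p ^ k.+1) (b %% p ^ e) (@goodT_core (p ^ e) a b) mb1 mb2 key1 key2 => x y H mb1 mb2 key1 key2.
by apply: H => //; lia.
Qed.

Lemma good_one_bound q a b : 1 < a < q -> 0 < b -> 0 < b %% q ->
  good q 1 (a - 1) (b - 1) -> a + b %% q <= q + 1.
Proof.
move=> ha b0 hb; have q0 : 0 < q by lia.
have := ltn_pmod b q0; rewrite /good (@modn_subn b) //; last by lia.
rewrite (modn_small (m := 1)) ?(modn_small (m := a - 1)) ?hb; lia.
Qed.

Lemma good_wrap q a b : a < q -> q <= b -> (b %% q).+1 < a ->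
  ~ good q (b %% q).+1 (a - (b %% q).+1) (b - (b %% q).+1).
Proof.
move=> aq qb hy; rewrite /good (@modn_subn b) ?ltnn; try lia.
rewrite (modn_small (m := _.+1)) ?(modn_small (m := a - _)); lia.
Qed.

(** At q = p^(k+1) two values of r suffice: r = 1 bounds the sum of the digits at p^k, and r = b mod
    q + 1 rules out a larger digit of a when b >= q. *)
Lemma pair_good_digits p k a b : odd p -> 2 < p ->
  p ^ k <= a < p ^ k.+1 -> p ^ k <= b -> 0 < k -> pair_good p a b ->
  [/\ forall e, 0 < e <= k -> half_residue (p ^ e) a /\ half_residue (p ^ e) b,
      a %/ p ^ k + b %/ p ^ k %% p < p &
      p ^ k.+1 <= b -> a %/ p ^ k <= b %/ p ^ k %% p].
Proof.
move=> op p2 /andP[ka ak] kb k0 h.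
have p1 : 1 < p by lia.
have hh e : 0 < e <= k -> half_residue (p ^ e) a /\ half_residue (p ^ e) b.
  move=> /andP[e0 ek]; apply: pair_good_half_residues => //.
  have : p ^ e <= p ^ k by rewrite leq_pexp2l // ltnW.
  by rewrite leq_min => ek2; rewrite !(leq_trans ek2).
have q3 : 2 < p ^ k by apply: leq_trans p2 _; rewrite -{1}[p]expn1 leq_pexp2l //; lia.
have good1 r : 0 < r < minn a b -> good (p ^ k.+1) r (a - r) (b - r) by apply: h.
have [ha0 hb0] : half_residue (p ^ k) a /\ half_residue (p ^ k) b by apply: hh; lia.
have eq : (p ^ k)./2.*2.+1 = p ^ k by rewrite -[RHS]odd_double_half oddX op orbT.
have ea := divn_eq a (p ^ k).
have eb := modn_mulS (p ^ k) p b; rewrite -expnSr in eb.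
have h0 : 0 < (p ^ k)./2 by move: (p ^ k) q3 => q; lia.
have y0 : 0 < b %% p ^ k.+1.
  by rewrite eb addn_gt0; case: hb0 => ->; rewrite ?h0 ?orbT.
split=> //.
  rewrite ltnNge; apply/negP => hp.
  have hm : p * p ^ k <= (a %/ p ^ k + b %/ p ^ k %% p) * p ^ k by rewrite leq_mul2r hp orbT.
  have : a + b %% p ^ k.+1 <= p ^ k.+1 + 1.
    have mab : 1 < minn a b by rewrite leq_min; move: (p ^ k) q3 ka kb => *; lia.
    apply: good_one_bound (good1 1 mab); rewrite ?ak ?andbT //.
      by move: mab; lia.
    by move: mab; lia.
  rewrite eb {1}ea expnS; move: hm; rewrite mulnDl.
  move: ha0 hb0; rewrite /half_residue; move: (p * p ^ k) (_ * _) (_ * _) => Q u v.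
  move: (a %% _) (b %% _) eq h0 {ea eb q3 ka kb}=> x y; move: (p ^ k)./2 => w; lia.
move=> bQ; rewrite leqNgt; apply/negP => hp.
have hm : (b %/ p ^ k %% p).+1 * p ^ k <= a %/ p ^ k * p ^ k by rewrite leq_mul2r hp orbT.
have lt : (b %% p ^ k.+1).+1 < a.
  rewrite eb {1}ea; move: hm ha0 hb0; rewrite mulSn /half_residue.
  move: (_ * _) (_ * _) => u v.
  move: (a %% _) (b %% _) eq h0 {ea eb ka kb good1 hp}=> x y; move: (p ^ k) q3 => q; lia.
apply: (good_wrap ak bQ lt); apply: good1.
by move: (p ^ k.+1) lt bQ ak {ea eb hm y0} => Q; move: (b %% Q) => y; lia.
Qed.

(** * Characteristic two *)

Lemma good_reduce q a b r : q %| 8 -> r <= a -> r <= b -> r <= 8 ->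
  good q r (a - r) (b - r) = good q r (a %% 8 + 8 - r) (b %% 8 + 8 - r).
Proof.
move=> q8 ra rb r8; have e x : r <= x -> (x - r) %% q = (x %% 8 + 8 - r) %% q.
  move=> rx; rewrite -(@modn_dvdm 8 (x - r)) // -(@modn_dvdm 8 (x %% 8 + 8 - r)) //.
  by congr (_ %% q); lia.
by rewrite /good (e a) // (e b).
Qed.

(* x stands for a when a < 8 and for a %% 8 + 8 otherwise; in the second case every
   r < 8 is admissible. *)
Lemma no_pair_good_two_large : all (fun x => all (fun y =>
    ~~ all (fun r => all (fun q => good q r (x %% 8 + 8 - r) (y + 8 - r)) [:: 2; 4; 8])
         (iota 1 (minn x 8).-1)) (iota 0 8)) (iota 4 12).
Proof. by vm_compute. Qed.

(** The moduli 2, 4 and 8 already exclude a >= 4, by a finite check on residues modulo 8. For a = 2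
    and a = 3 the conditions modulo 2 and 4 imply those for all higher powers. *)
Lemma pair_good_two a b : 1 < a -> a <= b ->
  pair_good 2 a b <-> (a = 2 /\ odd b) \/ (a = 3 /\ b %% 4 = 2).
Proof.
move=> a1 ab; split=> [h|].
  have hq q r : q \in [:: 2; 4; 8] -> 0 < r < a -> good q r (a - r) (b - r).
    rewrite !inE => /or3P[] /eqP-> hr; first by apply: (h 1); lia.
      by apply: (h 2); lia.
    by apply: (h 3); lia.
  case: (ltnP a 4) => a4.
    have h2 := hq 2 1 isT ltac:(lia); have h4 := hq 4 1 isT ltac:(lia).
    have [e|e] : a = 2 \/ a = 3 by lia.
      by left; split=> //; move: h2; rewrite e /good; lia.
    right; split=> //; have h42 := hq 4 2 isT ltac:(lia).
    have h22 := hq 2 2 isT ltac:(lia).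
    by move: h2 h4 h42 h22; rewrite e /good; lia.
  pose x := if a < 8 then a else a %% 8 + 8.
  have xin : x \in iota 4 12 by rewrite mem_iota /x; case: ifP; lia.
  have yin : b %% 8 \in iota 0 8 by rewrite mem_iota; lia.
  have /negP[] := allP (allP no_pair_good_two_large x xin) _ yin.
  apply/allP => r; rewrite mem_iota => hr; apply/allP => q qin.
  have r8 : 0 < r < 8 /\ r < a by move: hr; rewrite /x; case: ifP; lia.
  have -> : x %% 8 = a %% 8 by rewrite /x; case: ifP => // _; lia.
  rewrite -good_reduce ?hq //; try lia.
  by move: qin; rewrite !inE => /or3P[]/eqP->.
case=> -[-> hb] e r e0 hr.
  have [h1 h2] := @modn_exp_bounds 2 e 1 b isT e0; rewrite expn1 in h1 h2.
  have q1 : 2 <= 2 ^ e by rewrite -{1}[2]expn1 leq_pexp2l.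
  rewrite modn2 hb in h1 h2; by apply: goodT_core => //; move: (2 ^ e) h1 h2 q1 hr => q; move: (b %% q) => y; lia.
case: e e0 => // -[|e] _.
  by have [->|->] : r = 1 \/ r = 2 by lia.
have [h1 h2] := @modn_exp_bounds 2 e.+2 2 b isT isT; rewrite -[2 ^ 2]/4 hb in h1 h2.
have q1 : 2 <= 2 ^ e.+2 by rewrite -{1}[2]expn1 leq_pexp2l.
by apply: goodT_core => //; move: (2 ^ e.+2) h1 h2 q1 hr => q; move: (b %% q) => y; lia.
Qed.

(** * A determinant of binomial coefficients *)

Section FloorSums.

Variable q : nat.
Hypothesis q0 : 0 < q.

(** For N <= 3q this is the sum of x %/ q over x < N, in a form fit for linear arithmetic. *)
Let f (N : nat) := (N - q) + (N - 2 * q).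

Let fS x : x < 3 * q -> f x.+1 = f x + x %/ q.
Proof.
move=> hx; have -> : x %/ q = (q <= x) + (2 * q <= x).
  case: (ltnP x q) => h1; first by rewrite divn_small //; lia.
  have -> : x = q + (x - q) by lia.
  rewrite divnDl // divnn q0; case: (ltnP (x - q) q) => h2.
    by rewrite divn_small //; lia.
  have -> : x - q = q + (x - q - q) by lia.
  by rewrite divnDl // divnn q0 divn_small; lia.
by rewrite /f; lia.
Qed.

Let floor_sum_small u w r : u < q -> w < q -> r <= q ->
  \sum_(s < r) (s %/ q + (u + w + s) %/ q) + (f (u + w) + f (u + r) + f (w + r)) =
  \sum_(s < r) ((u + s) %/ q + (w + s) %/ q) + (f r + f (u + w + r) + f u + f w).
Proof.
move=> hu hw; elim: r => [|r IH] hr.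
  by rewrite !big_ord0 !addn0 /f sub0n; lia.
rewrite !big_ord_recr /= !addnS !fS; try lia.
move: (IH (ltnW hr)); move: (\sum_(s < r) _) (\sum_(s < r) _) => S T.
move: (f _) (f _) (f _) (f _) (f _) (f _) (f _) => ? ? ? ? ? ? ?.
move: (_ %/ q) (_ %/ q) (_ %/ q) (_ %/ q); lia.
Qed.

Let floor_sum_full u w : u < q -> w < q ->
  \sum_(s < q) (s %/ q + (u + w + s) %/ q) = \sum_(s < q) ((u + s) %/ q + (w + s) %/ q).
Proof.
move=> hu hw; have := floor_sum_small hu hw (leqnn q).
have -> : f (u + q) = f u + u by rewrite /f; lia.
have -> : f (w + q) = f w + w by rewrite /f; lia.
have -> : f (u + w + q) = f (u + w) + (u + w) by rewrite /f; lia.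
have -> : f q = 0 by rewrite /f; lia.
lia.
Qed.

(** A full period of q terms contributes equally to both sides, so only r mod q matters. *)
Let floor_sum_reduced u w r : u < q -> w < q ->
  \sum_(s < r) (s %/ q + (u + w + s) %/ q) +
    (f (u + w) + f (u + r %% q) + f (w + r %% q)) =
  \sum_(s < r) ((u + s) %/ q + (w + s) %/ q) +
    (f (r %% q) + f (u + w + r %% q) + f u + f w).
Proof.
move=> hu hw; have := floor_sum_small hu hw (ltnW (ltn_pmod r q0)).
move: (f _ + _ + _) (f _ + _ + _ + _) => A B.
move=> h; have H t : \sum_(s < t * q + r %% q) (s %/ q + (u + w + s) %/ q) + A =
    \sum_(s < t * q + r %% q) ((u + s) %/ q + (w + s) %/ q) + B.
  elim: t => // t; rewrite mulSn -addnA; move: (t * q + r %% q) => m IH.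
  rewrite !big_split_ord /= floor_sum_full // -!addnA; congr addn.
  have e c x : (c + (q + x)) %/ q = (c + x) %/ q + 1.
    by rewrite addnCA divnDl // divnn q0 addnC.
  rewrite (eq_bigr (fun s : 'I_m => s %/ q + (u + w + s) %/ q + 2)); last first.
    by move=> s _; rewrite e -{1}[q + s]add0n e; lia.
  rewrite [in RHS](eq_bigr (fun s : 'I_m => (u + s) %/ q + (w + s) %/ q + 2)); last first.
    by move=> s _; rewrite !e; lia.
  by rewrite big_split [in RHS]big_split /= ![_ + \sum_(_ < m) 2]addnC -!addnA IH.
by have := H (r %/ q); rewrite -divn_eq.
Qed.

(** The two sums are the terms at q in Legendre's formula for denominator and numerator of
    MacMahon's product. With residues x, y, z the difference is piecewise linear in x + y + z and
    the pairwise sums. *)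
Lemma floor_sum_good u w r :
  (\sum_(s < r) ((u + s) %/ q + (w + s) %/ q) <=
   \sum_(s < r) (s %/ q + (u + w + s) %/ q)) /\
  (\sum_(s < r) (s %/ q + (u + w + s) %/ q) ==
   \sum_(s < r) ((u + s) %/ q + (w + s) %/ q)) = good q r u w.
Proof.
have hu := ltn_pmod u q0; have hw := ltn_pmod w q0; have hr := ltn_pmod r q0.
have e x s : (x + s) %/ q = x %/ q + (x %% q + s) %/ q.
  by rewrite {1}(divn_eq x q) -addnA divnMDl.
have := floor_sum_reduced r hu hw.
set X := \sum_(s < r) _; set Y := \sum_(s < r) _ => h.
have -> : \sum_(s < r) ((u + s) %/ q + (w + s) %/ q) = Y + r * (u %/ q + w %/ q).
  rewrite -[r in r * _]card_ord -sum_nat_const -big_split /=; apply: eq_bigr => s _.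
  by rewrite (e u) (e w); lia.
have -> : \sum_(s < r) (s %/ q + (u + w + s) %/ q) = X + r * (u %/ q + w %/ q).
  rewrite -[r in r * _]card_ord -sum_nat_const -big_split /=; apply: eq_bigr => s _.
  rewrite -[u + w + s]addnA e [u %% q + (w + s)]addnCA e !addnA.
  by rewrite [w %% q + u %% q]addnC addnAC; congr addn; rewrite addnAC.
rewrite leq_add2r eqn_add2r /good; move: X Y h => X Y.
move: (u %% q) (w %% q) (r %% q) hu hw hr => x y z hx hy hz.
rewrite /f => h.
have {}h : X + (x + y - q + (x + z - q) + (y + z - q)) = Y + (x + y + z - q + (x + y + z - 2 * q)).
  lia.
case: (leqP (x + y + z) q) => c1; first lia.
case: (leqP (x + y + z) (2 * q)) => c2; lia.
Qed.
End FloorSums.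

Local Open Scope ring_scope.

(** Row s holds the coefficients of (z + y)^(k+s) at r consecutive powers of z, starting with
    z^u. *)
Definition binomial_mx (R : comNzRingType) (r k u : nat) : 'M[R]_r :=
  \matrix_(s, t) ('C(k + s, u + t))%:R.

(** Vandermonde's convolution factors the matrix into a lower unitriangular, an upper unitriangular
    and a diagonal matrix with entries t!. *)
Lemma det_ffact_mx (R : comNzRingType) (r w : nat) :
  \det (\matrix_(s < r, t < r) ((w + s) ^_ t)%:R : 'M[R]_r) = (\prod_(t < r) t`!)%:R.
Proof.
pose P := \matrix_(s < r, k < r) ('C(s, k))%:R : 'M[R]_r.
pose U := \matrix_(k < r, t < r) (if k <= t then 'C(w, t - k) else 0)%N%:R : 'M[R]_r.
have -> : \matrix_(s < r, t < r) ((w + s) ^_ t)%:R =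
    P *m U *m diag_mx (\row_t (t`!)%:R).
  apply/matrixP => s t; rewrite mul_mx_diag !mxE -bin_ffact natrM; congr (_ * _).
  rewrite addnC -binomial.Vandermonde natr_sum (big_ord_widen r (fun j => ('C(s, j) * 'C(w, t - j))%:R)) //.
  rewrite [RHS](bigID (fun k : 'I_r => (k < t.+1)%N)) /= [X in _ + X]big1 ?addr0.
    by apply: eq_bigr => k kt; rewrite !mxE -ltnS kt natrM.
  by move=> k kt; rewrite !mxE -ltnS ifF ?mulr0 //; apply/negbTE.
rewrite !det_mulmx det_diag det_trig; last first.
  by apply/is_trig_mxP => i j ij; rewrite mxE bin_small.
rewrite -det_tr det_trig; last first.
  by apply/is_trig_mxP => i j ij; rewrite !mxE ifF //; apply/negbTE; rewrite -ltnNge.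
rewrite [X in X * _ * _]big1 ?[X in _ * X * _]big1 ?mul1r.
- by rewrite natr_prod; apply: eq_bigr => t _; rewrite mxE.
- by move=> i _; rewrite !mxE leqnn subnn bin0.
- by move=> i _; rewrite !mxE binn.
Qed.

(** Scaling row s by (w+s)! and column t by (u+t)! turns the entries into (u+w+s)! times a falling
    factorial. The identity avoids division and so holds over every commutative ring. *)
Lemma det_binomial_mx (R : comNzRingType) (r u w : nat) :
  \det (binomial_mx R r (u + w) u) * (\prod_(s < r) ((u + s)`! * (w + s)`!))%:R =
  (\prod_(s < r) (s`! * (u + w + s)`!))%:R.
Proof.
pose D x := diag_mx (\row_(s < r) ((x + s)`!)%:R) : 'M[R]_r.
have : D w *m binomial_mx R r (u + w) u *m D u =
    D (u + w)%N *m \matrix_(s < r, t < r) ((w + s) ^_ t)%:R.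
  apply/matrixP => s t; rewrite mul_mx_diag !mul_diag_mx !mxE -!natrM; congr _%:R.
  case: (leqP t (w + s)) => h.
    rewrite -(ffact_fact h) -(@bin_fact (u + w + s) (u + t)); last by lia.
    have -> : (u + w + s - (u + t) = w + s - t)%N by lia.
    move: ((w + s) ^_ t) ((_ - _)`!) ('C(_, _)) ((u + t)`!) => x y c z.
    by lia.
  by rewrite bin_small ?ffact_small //; [rewrite muln0 mul0n muln0|lia].
move/(congr1 determinant); rewrite !det_mulmx !det_diag det_ffact_mx.
have e x : \prod_(i < r) (\row_(s < r) ((x + s)`!)%:R) 0 i = (\prod_(s < r) (x + s)`!)%:R :> R.
  by rewrite natr_prod; apply: eq_bigr => i _; rewrite mxE.
rewrite !e => h; rewrite !big_split /= !natrM [in RHS]mulrC -h.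
by rewrite mulrA mulrAC [_ * \det _]mulrC.
Qed.

Local Open Scope nat_scope.

Lemma logn_fact_bound p n E : prime p -> n < E ->
  logn p n`! = \sum_(1 <= k < E) n %/ p ^ k.
Proof.
move=> pp nE; rewrite logn_fact // [RHS](big_cat_nat (n := n.+1)) //=.
rewrite -[LHS]addn0; congr addn; rewrite big_nat_cond big1 // => k /andP[/andP[nk _] _].
by rewrite divn_small // (leq_trans _ (ltnW (ltn_expl _ (prime_gt1 pp)))).
Qed.

Lemma logn_prod (I : Type) (r : seq I) p (F : I -> nat) :
  (forall i, 0 < F i) -> logn p (\prod_(i <- r) F i) = \sum_(i <- r) logn p (F i).
Proof.
move=> F0; elim: r => [|i r IH]; first by rewrite !big_nil logn1.
by rewrite !big_cons lognM ?IH // prodn_gt0.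
Qed.

(** The determinant comes from a nonzero integer. Its p-adic valuation is a sum over the powers of p
    of nonnegative differences of floor sums, hence vanishes exactly when each of them does. *)
Lemma det_binomial_mx_neq0 (K : fieldType) p r u w : p \in [pchar K]%R ->
  (\det (binomial_mx K r (u + w) u) != 0)%R <->
  (forall e, 0 < e -> good (p ^ e) r u w).
Proof.
move=> hp; have pp := pcharf_prime hp; have p0 := prime_gt0 pp.
pose M : 'M[int]_r := binomial_mx int r (u + w) u.
have eM : (\det (binomial_mx K r (u + w) u) = (\det M)%:~R)%R.
  rewrite -det_map_mx; congr (\det _)%R; apply/matrixP => i j.
  by rewrite !mxE rmorph_nat.
have hN : `|\det M|%N * \prod_(s < r) ((u + s)`! * (w + s)`!) =
    \prod_(s < r) (s`! * (u + w + s)`!).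
  by have /(congr1 absz) := det_binomial_mx int r u w; rewrite abszM !natz !absz_nat.
have posF (x y : 'I_r -> nat) : 0 < \prod_(s < r) ((x s)`! * (y s)`!).
  by rewrite prodn_gt0 // => s; rewrite muln_gt0 !fact_gt0.
have N0 : 0 < `|\det M|%N.
  rewrite lt0n; apply/eqP => N0; move: hN; rewrite N0 mul0n => h.
  by have := posF (fun s => s : nat) (fun s => u + w + s); rewrite -h.
have dE : (p %| `|\det M|%N) = ((\det M)%:~R == 0 :> K)%R.
  by rewrite -(dvdz_pcharf hp) dvdzE absz_nat.
have -> : (\det (binomial_mx K r (u + w) u) != 0)%R <-> logn p `|\det M|%N = 0.
  rewrite eM -dE; split=> [h|/eqP].
    by apply/eqP; rewrite -leqn0 leqNgt logn_gt0 mem_primes pp N0.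
  by rewrite -leqn0 leqNgt logn_gt0 mem_primes pp N0.
(* A common cut-off E for all Legendre sums allows the two finite sums to be compared term by
   term. *)
have key E : u + w + r < E -> (logn p `|\det M|%N = 0 <->
    forall e, 0 < e < E -> good (p ^ e) r u w).
  move=> hE; have := congr1 (logn p) hN.
  rewrite lognM // ?posF // !logn_prod; try by move=> s; rewrite muln_gt0 !fact_gt0.
  have sumE (x y : nat -> nat) : (forall s, s < r -> x s < E /\ y s < E) ->
      \sum_(s < r) logn p ((x s)`! * (y s)`!) =
      \sum_(k < E.-1) \sum_(s < r) (x s %/ p ^ k.+1 + y s %/ p ^ k.+1).
    move=> h; rewrite exchange_big /=; apply: eq_bigr => s _.
    have [hx hy] := h s (ltn_ord s).
    rewrite lognM ?fact_gt0 // !(@logn_fact_bound p _ E) //.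
    by rewrite !big_add1 !big_mkord big_split.
  rewrite (sumE (fun s => u + s) (fun s => w + s)); last by move=> s sr; lia.
  rewrite (sumE (fun s => s) (fun s => u + w + s)); last by move=> s sr; lia.
  set Y := \sum_(k < _) _; set X := \sum_(k < _) _ => h.
  have [_] : Y <= X ?= iff [forall (k : 'I_E.-1 | true), good (p ^ k.+1) r u w].
    apply: leqif_sum => k _; have q0 : 0 < p ^ k.+1 by rewrite expn_gt0 p0.
    by have [le eq] := floor_sum_good q0 u w r; split=> //; rewrite eq_sym.
  rewrite -h -[Y in Y == _]add0n eqn_add2r eq_sym => e0.
  split=> [/eqP|hg].
    rewrite e0 => /forallP hg e /andP[e1 eE].
    have e2 : e.-1 < E.-1 by lia.
    by have := hg (Ordinal e2); rewrite /= prednK.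
  by apply/eqP; rewrite e0; apply/forallP => k; apply: hg; have := ltn_ord k; lia.
split=> [l0 e e0|h].
  have hE : u + w + r < u + w + r + e.+1 by lia.
  by apply: ((key _ hE).1 l0); lia.
by apply/(key (u + w + r).+1) => // e /andP[e0 _]; exact: h.
Qed.

(** * Binary forms *)

Local Open Scope ring_scope.

Lemma binomial_mx_unitri (K : fieldType) r : row_free (binomial_mx K r 0 0).
Proof.
rewrite row_free_unit unitmxE det_trig; last first.
  by apply/is_trig_mxP => i j ij; rewrite mxE bin_small.
by rewrite big1 ?unitr1 // => i _; rewrite mxE binn.
Qed.

Section BinaryForms.

Variables (K : fieldType) (R : comNzRingType) (phi : {rmorphism K -> R}).
Variables (z y v : R).

(** In the basis (z+y)^s y^(i-s), multiplication by (z+y)^k only shifts exponents, which makes the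
    matrix entries plain binomial coefficients. The factor v generates the copy of the two-variable
    algebra. *)
Definition binary_form i (c : 'rV[K]_i.+1) : R :=
  \sum_(s < i.+1) phi (c 0 s) * ((z + y) ^+ s * y ^+ (i - s) * v).

Lemma mul_binary_form i k (c : 'rV[K]_i.+1) :
  (z + y) ^+ k * binary_form c =
  \sum_(u < (k + i).+1)
    phi (\sum_(s < i.+1) c 0 s * 'C(k + s, u)%:R) * (z ^+ u * y ^+ (k + i - u) * v).
Proof.
under [RHS]eq_bigr do rewrite rmorph_sum mulr_suml.
rewrite exchange_big /= /binary_form mulr_sumr; apply: eq_bigr => s _.
under eq_bigr do rewrite rmorphM rmorph_nat -mulrA.
rewrite -mulr_sumr mulrCA; congr (_ * _).
rewrite !mulrA -exprD [z + y]addrC exprDn !mulr_suml.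
have si := ltn_ord s.
rewrite [RHS](bigID (fun u : 'I__ => (u < (k + s).+1)%N)) /= [X in _ + X]big1 ?addr0; last first.
  by move=> u; rewrite -leqNgt => h; rewrite bin_small ?mul0r.
rewrite (big_ord_widen (k + i).+1 (fun u => y ^+ (k + s - u) * z ^+ u *+ 'C(k + s, u) * y ^+ (i - s) * v)); last by lia.
apply: eq_bigr => u us; rewrite mulrA -mulr_natl -!mulrA; congr (_ * _).
rewrite mulrCA; congr (_ * _); rewrite mulrA -exprD; congr (y ^+ _ * _); lia.
Qed.

Variables (a b : nat).
Hypotheses (a0 : (0 < a)%N) (b0 : (0 < b)%N).
Hypotheses (za : z ^+ a * v = 0) (yb : y ^+ b * v = 0).
Hypothesis (soc : z ^+ a.-1 * y ^+ b.-1 * v != 0).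

Lemma monomial_vanish s t : (a <= s)%N || (b <= t)%N -> z ^+ s * y ^+ t * v = 0.
Proof.
case/orP => [/subnK<-|/subnK<-]; rewrite exprD.
  by rewrite -!mulrA (mulrCA (z ^+ a)) za !mulr0.
by rewrite -!mulrA yb !mulr0.
Qed.

(** Multiplying by the monomial complementary to z^u y^(N-u) kills all other terms and leaves e u
    times the nonzero socle element. *)
Lemma binary_coef_eq0 N (e : nat -> K) :
  \sum_(u < N.+1) phi (e u) * (z ^+ u * y ^+ (N - u) * v) = 0 <->
  (forall u, (u < a)%N -> (u <= N)%N -> (N - u < b)%N -> e u = 0).
Proof.
split=> [h u ua uN ub|h].
  case: (eqVneq (e u) 0) => // eu0.
  have nz : phi (e u) * (z ^+ a.-1 * y ^+ b.-1 * v) = 0.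
    move/(congr1 (fun x => z ^+ (a.-1 - u) * y ^+ (b.-1 - (N - u)) * x)): h.
    rewrite mulr0 mulr_sumr (bigD1 (Ordinal (uN : (u < N.+1)%N))) //= big1 ?addr0.
      rewrite mulrCA [z ^+ _ * _ * (_ * v)]mulrA mulrACA -!exprD => <-.
      by congr (_ * (_ ^+ _ * _ ^+ _ * _)); lia.
    move=> t tu; rewrite mulrCA [z ^+ _ * _ * (_ * v)]mulrA mulrACA -!exprD monomial_vanish ?mulr0 //.
    have := ltn_ord t; have : (t : nat) <> u by move=> e'; case/eqP: tu; apply/val_inj.
    by lia.
  case/eqP: soc; rewrite -[LHS]mul1r -(rmorph1 phi) -(mulVf eu0) rmorphM -mulrA.
  by rewrite nz mulr0.
rewrite big1 // => u _.
have uN := ltn_ord u.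
case: (ltnP u a) => ua; last by rewrite monomial_vanish ?mulr0 // ua.
case: (ltnP (N - u) b) => ub; last by rewrite monomial_vanish ?mulr0 // ub orbT.
by rewrite h ?rmorph0 ?mul0r.
Qed.

Lemma mul_binary_form_eq0 i k (c : 'rV[K]_i.+1) :
  (z + y) ^+ k * binary_form c = 0 <->
  (forall u, (u < a)%N -> (u <= k + i)%N -> (k + i - u < b)%N ->
     \sum_(s < i.+1) c 0 s * 'C(k + s, u)%:R = 0).
Proof. by rewrite mul_binary_form (binary_coef_eq0 (k + i) (fun u => \sum_(s < i.+1) c 0 s * 'C(k + s, u)%:R)). Qed.

Lemma binary_form_eq0 i (c : 'rV[K]_i.+1) : (i < minn a b)%N ->
  binary_form c = 0 -> c = 0.
Proof.
move=> iab; rewrite -[binary_form c]mul1r -(expr0 (z + y)) => /mul_binary_form_eq0 h.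
apply: (row_free_inj (binomial_mx_unitri K i.+1)); rewrite mul0mx.
apply/rowP => u; rewrite !mxE -[RHS](h u); last by lia.
- by apply: eq_bigr => s _; rewrite mxE.
- by have := ltn_ord u; lia.
- by have := ltn_ord u; lia.
Qed.

(** With r = i + 1 the product has degree a + b - r - 1, so exactly the r exponents from a - r to a
    - 1 of z survive: the matrix is square. *)
Lemma lefschetz_binary_form i (c : 'rV[K]_i.+1) : (i < minn a b)%N ->
  (z + y) ^+ (a + b - i.+1.*2) * binary_form c = 0 <->
  c *m binomial_mx K i.+1 ((a - i.+1) + (b - i.+1)) (a - i.+1) = 0.
Proof.
move=> iab; rewrite mul_binary_form_eq0.
have -> : (a + b - i.+1.*2 = (a - i.+1) + (b - i.+1))%N by lia.
split=> [h|/rowP h u ua uk ub].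
  apply/rowP => t; rewrite !mxE; have ti := ltn_ord t.
  rewrite -[RHS](h (a - i.+1 + t)%N); try lia.
  by apply: eq_bigr => s _; rewrite mxE.
have tP : (u - (a - i.+1) < i.+1)%N by lia.
have := h (Ordinal tP); rewrite !mxE => h0; rewrite -[RHS]h0.
by apply: eq_bigr => s _; rewrite mxE /= subnKC //; lia.
Qed.

(** One power more than in [lefschetz_binary_form] leaves only i surviving monomials against i + 1
    coefficients, so a nonzero kernel vector exists. *)
Lemma primitive_binary_form i : (i < minn a b)%N ->
  exists2 c : 'rV[K]_i.+1, binary_form c != 0 &
    (z + y) ^+ (a + b - i.*2.+1) * binary_form c = 0.
Proof.
move=> iab; pose k := (a + b - i.*2.+1)%N.
pose W := \matrix_(s < i.+1, t < i) ('C(k + s, a - i + t))%:R : 'M[K]_(i.+1, i).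
have /rowV0Pn[c /sub_kermxP /rowP cW c0] : kermx W != 0.
  rewrite kermx_eq0 /row_free neq_ltn ltnS; apply/orP; left.
  exact: rank_leq_col.
exists c; first by apply: contra c0 => /eqP/(binary_form_eq0 iab)->.
apply/mul_binary_form_eq0 => u ua uk ub.
have tP : (u - (a - i) < i)%N by lia.
have := cW (Ordinal tP); rewrite !mxE => h; rewrite -[RHS]h.
by apply: eq_bigr => s _; rewrite mxE /= subnKC //; lia.
Qed.

End BinaryForms.

Section BinaryFormsDet.

Variables (K : fieldType) (p : nat) (hp : p \in [pchar K]).
Variables (R : comNzRingType) (phi : {rmorphism K -> R}).
Variables (z y v : R) (a b : nat).
Hypotheses (a0 : (0 < a)%N) (b0 : (0 < b)%N).
Hypotheses (za : z ^+ a * v = 0) (yb : y ^+ b * v = 0).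
Hypothesis (soc : z ^+ a.-1 * y ^+ b.-1 * v != 0).

Lemma pair_good_lefschetz : pair_good p a b -> forall i (c : 'rV[K]_i.+1), (i < minn a b)%N ->
  (z + y) ^+ (a + b - i.+1.*2) * binary_form phi z y v c = 0 -> c = 0.
Proof.
move=> pg i c iab /(lefschetz_binary_form phi a0 b0 za yb soc c iab) h.
have : \det (binomial_mx K i.+1 ((a - i.+1) + (b - i.+1)) (a - i.+1)) != 0.
  apply/(det_binomial_mx_neq0 i.+1 (a - i.+1) (b - i.+1) hp) => e e0.
  case: (ltnP i.+1 (minn a b)) => lt; first exact: pg.
  (* At r = min(a, b), outside the range of [pair_good], one side of the box is empty. *)
  have : (a - i.+1 = 0)%N \/ (b - i.+1 = 0)%N by lia.
  by case=> ->; rewrite /good mod0n eqxx ?orbT.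
rewrite -unitfE -unitmxE -row_free_unit => /row_free_inj; apply.
by rewrite h mul0mx.
Qed.

Lemma lefschetz_pair_good :
  (forall i (c : 'rV[K]_i.+1), (i < minn a b)%N ->
     (z + y) ^+ (a + b - i.+1.*2) * binary_form phi z y v c = 0 ->
     binary_form phi z y v c = 0) ->
  pair_good p a b.
Proof.
move=> inj e [|i] // e0 /andP[_ iab]; move: e e0.
apply/(det_binomial_mx_neq0 i.+1 (a - i.+1) (b - i.+1) hp).
rewrite -unitfE -unitmxE -row_free_unit -kermx_eq0; apply/rowV0P => c /sub_kermxP h.
have {}iab := ltnW iab.
apply: (binary_form_eq0 (phi := phi) a0 b0 za yb soc iab).
by apply: (inj _ _ iab); apply/(lefschetz_binary_form phi a0 b0 za yb soc c iab).
Qed.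

End BinaryFormsDet.

(** * The quotient ring *)

Local Open Scope quotient_scope.

Lemma mcoeffMX_eq0 n (R : nzRingType) (f : {mpoly R[n]}) (k m : 'X_{1..n}) :
  ~~ (k <= m)%MM -> (f * 'X_[k])@_m = 0.
Proof.
move=> km; rewrite [f]mpolyE mulr_suml raddf_sum big1 //= => m' _.
rewrite -scalerAl -mpolyXD mcoeffZ mcoeffX; case: eqP => [e|]; last by rewrite mulr0.
by rewrite -e lem_addl in km.
Qed.

Section Vanish.

Variables (K : fieldType) (n : nat).
Implicit Types (f g : {mpoly K[n]}) (d : 'I_n -> nat).

(** Membership in the monomial ideal, read off coefficients. It makes sense for all exponents,
    including d_j mod p, which may be 1. *)
Definition vanish d f := forall m : 'X_{1..n}, (forall i, m i < d i)%N -> f@_m = 0.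

Lemma vanish0 d : vanish d 0.
Proof. by move=> m _; rewrite mcoeff0. Qed.

Lemma vanishD d f g : vanish d f -> vanish d g -> vanish d (f + g).
Proof. by move=> hf hg m md; rewrite mcoeffD hf // hg // addr0. Qed.

Lemma vanishN d f : vanish d f -> vanish d (- f).
Proof. by move=> hf m md; rewrite mcoeffN hf // oppr0. Qed.

Lemma vanish_sum d (I : Type) (r : seq I) (P : pred I) (F : I -> {mpoly K[n]}) :
  (forall i, P i -> vanish d (F i)) -> vanish d (\sum_(i <- r | P i) F i).
Proof. by move=> h; elim/big_ind: _ => //; [exact: vanish0|exact: vanishD]. Qed.

Lemma vanishZ d c f : vanish d f -> vanish d (c *: f).
Proof. by move=> hf m md; rewrite mcoeffZ hf // mulr0. Qed.

Lemma vanishMX d f k : vanish d f -> vanish d (f * 'X_[k]).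
Proof.
move=> hf m md; case: (boolP (k <= m)%MM) => [km|]; last exact: mcoeffMX_eq0.
rewrite -(submK km) addmC mcoeffMX; apply: hf => i.
by rewrite mnmBE (leq_ltn_trans (leq_subr _ _)).
Qed.

Lemma vanishM d f g : vanish d f -> vanish d (f * g).
Proof.
move=> hf; rewrite [g]mpolyE mulr_sumr; apply: vanish_sum => m _.
by rewrite -scalerAr; apply/vanishZ/vanishMX.
Qed.

Lemma vanish_X d (m : 'X_{1..n}) i : (d i <= m i)%N -> vanish d 'X_[m].
Proof.
move=> dm m' m'd; rewrite mcoeffX; case: eqP => // e.
by have := m'd i; rewrite -e ltnNge dm.
Qed.

Lemma vanishP d f : in_power_ideal d f <-> vanish d f.
Proof.
split=> [[g ->]|hf].
  apply: vanish_sum => i _; rewrite mulrC; apply: vanishM.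
  by rewrite mpolyXn; apply: (@vanish_X _ _ i); rewrite mulmnE mnm1E eqxx mul1n.
(* Each monomial of f is assigned to one variable whose power divides it. *)
pose q (m : 'X_{1..n}) := [pick i | (d i <= m i)%N].
exists (fun i => \sum_(m <- msupp f | q m == Some i) f@_m *: 'X_[m - U_(i) *+ d i]).
rewrite {1}[f]mpolyE big_seq.
rewrite (eq_bigr (fun m => \sum_(i < n | q m == Some i) f@_m *: 'X_[m])); last first.
  move=> m mf; have : f@_m != 0 by rewrite -mcoeff_msupp.
  rewrite /q; case: pickP => [i _ _|h].
    by rewrite (big_pred1 i) // => j /=; rewrite (inj_eq (@Some_inj _)) eq_sym.
  by rewrite hf ?eqxx // => i; rewrite ltnNge h.
rewrite (exchange_big_dep predT) //=.
apply: eq_bigr => i _; rewrite mulr_suml -big_seq_cond; apply: eq_bigr => m.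
rewrite /q; case: pickP => // j dj /eqP[<-].
rewrite -scalerAl mpolyXn -mpolyXD submK //.
by apply/mnm_lepP => l; rewrite mulmnE mnm1E; case: eqP => [<-|]; rewrite ?mul1n.
Qed.

End Vanish.

Section Quotient.

Variables (K : fieldType) (n : nat) (d : 'I_n -> nat).
Hypothesis hd : forall i, (2 <= d i)%N.

Local Notation A := (monomial_ci K hd).
Local Notation P := {mpoly K[n]}.

Definition toA (f : P) : A := \pi_{ideal_quot (power_ideal hd)} f.

HB.instance Definition _ := GRing.RMorphism.copy toA (\pi_{ideal_quot (power_ideal hd)} : P -> A).

Lemma toA_eq0 f : toA f = 0 <-> vanish d f.
Proof.
rewrite -vanishP.
have -> : (toA f = 0) <-> (f \in power_ideal hd).
  rewrite -[f in f \in _]subr0 Quotient.idealrBE.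
  rewrite -(rmorph0 toA).
  by split=> h; [apply: (introT eqP)|apply: (elimT eqP)].
by split=> /power_idealP.
Qed.

Definition scalar : K -> A := toA \o @mpolyC n K.
HB.instance Definition _ := GRing.RMorphism.on scalar.

Lemma toAZ c f : toA (c *: f) = scalar c * toA f.
Proof. by rewrite -mul_mpolyC rmorphM. Qed.

Local Notation deg := (@monomial_ci_graded K n d hd).

Lemma deg_toA i f : f \is i.-homog -> deg i (toA f).
Proof. by exists f. Qed.

Lemma degM i j x y : deg i x -> deg j y -> deg (i + j) (x * y).
Proof. by move=> [f hf ->] [g hg ->]; exists (f * g); rewrite ?dhomogM // rmorphM. Qed.

Lemma deg1 : deg 0 1.
Proof. by exists 1; rewrite ?dhomog1 // rmorph1. Qed.

Lemma degX i x k : deg i x -> deg (i * k) (x ^+ k).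
Proof. by move=> [f hf ->]; exists (f ^+ k); rewrite ?dhomogMn // rmorphXn. Qed.

Lemma deg0 i : deg i 0.
Proof. by exists 0; rewrite ?dhomog0 // rmorph0. Qed.

Lemma degD i x y : deg i x -> deg i y -> deg i (x + y).
Proof. by move=> [f hf ->] [g hg ->]; exists (f + g); rewrite ?dhomogD // rmorphD. Qed.

Lemma degN i x : deg i x -> deg i (- x).
Proof. by move=> [f hf ->]; exists (- f); rewrite ?dhomogN // rmorphN. Qed.

Lemma degZ i c x : deg i x -> deg i (scalar c * x).
Proof. by move=> [f hf ->]; exists (c *: f); rewrite ?dhomogZ //; rewrite -toAZ. Qed.

Lemma deg_sum i (I : Type) (r : seq I) (P' : pred I) (F : I -> A) :
  (forall j, P' j -> deg i (F j)) -> deg i (\sum_(j <- r | P' j) F j).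
Proof. by move=> h; elim/big_ind: _ => //; [exact: deg0|exact: degD]. Qed.

Lemma deg_var i : deg 1 (toA 'X_i).
Proof. by apply: deg_toA; rewrite dhomogX /= mdeg1. Qed.

Definition socle_deg := (\sum_(i < n) (d i).-1)%N.

Lemma var_nilp i : toA 'X_i ^+ d i = 0.
Proof.
by rewrite -rmorphXn /= mpolyXn; apply/toA_eq0/(@vanish_X _ _ _ _ i); rewrite mulmnE mnm1E eqxx mul1n.
Qed.

Lemma mdeg_le_socle (m : 'X_{1..n}) : (forall i, m i < d i)%N -> (mdeg m <= socle_deg)%N.
Proof. by move=> md; rewrite mdegE leq_sum // => i _; have := md i; lia. Qed.

Lemma deg_gt_socle i x : (socle_deg < i)%N -> deg i x -> x = 0.
Proof.
move=> Di [f hf ->]; apply/toA_eq0 => m md.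
apply: (dhomog_nemf_coeff hf); rewrite neq_ltn; apply/orP; left.
exact: leq_ltn_trans (mdeg_le_socle md) Di.
Qed.

(** If x has a nonzero coefficient at the monomial m, multiplying by the complement of m moves it to
    the socle monomial. *)
Lemma pairing_nondegenerate i x : (i <= socle_deg)%N -> deg i x ->
  (forall z, deg (socle_deg - i) z -> x * z = 0) -> x = 0.
Proof.
move=> iD [f hf ->] h; apply/toA_eq0 => m md.
case: (eqVneq (mdeg m) i) => [mi|]; last exact: dhomog_nemf_coeff.
pose top : 'X_{1..n} := [multinom (d j).-1 | j < n].
have mt : (m <= top)%MM by apply/mnm_lepP => j; rewrite mnmE; have := md j; lia.
have dt : mdeg top = socle_deg by rewrite mdegE; apply: eq_bigr => j _; rewrite mnmE.
have := h (toA 'X_[top - m]); rewrite -rmorphM /= => h0.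
have /h0/toA_eq0/(_ top) : deg (socle_deg - i) (toA 'X_[top - m]).
  apply: deg_toA; rewrite dhomogX /= -dt -mi -{2}(submK mt) mdegD addnK; exact: eqxx.
rewrite -{2}(submK mt) mcoeffMX; apply=> j; rewrite mnmE; have := hd j; lia.
Qed.

Definition centered_lefschetz (l : A) :=
  forall i x, (i.*2 <= socle_deg)%N -> deg i x -> l ^+ (socle_deg - i.*2) * x = 0 -> x = 0.

(** If l^m x = 0 and l^m maps A_i onto the complementary degree, then x annihilates that degree and
    is 0 by the pairing. *)
Lemma strong_lefschetz_centered :
  strong_lefschetz deg -> exists2 l, deg 1 l & centered_lefschetz l.
Proof.
case=> l l1 h; exists l => // i x iD xi.
case: (eqVneq (socle_deg - i.*2)%N 0%N) => [->|m0]; first by rewrite mul1r.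
have m1 : (1 <= socle_deg - i.*2)%N by lia.
have e : (i + (socle_deg - i.*2) = socle_deg - i)%N by lia.
case: (h i _ m1) => [inj lx0|surj lx0].
  by apply: inj => //; [exact: deg0|rewrite lx0 mulr0].
apply: (@pairing_nondegenerate i) => //; first by lia.
move=> z; rewrite -e => /surj[w wi <-].
by rewrite mulrA [x * _]mulrC lx0 mul0r.
Qed.

Lemma centered_lefschetz_inj l i m x : centered_lefschetz l -> (i.*2 + m <= socle_deg)%N ->
  deg i x -> l ^+ m * x = 0 -> x = 0.
Proof.
move=> cl im xi lx0; apply: cl xi _; first by lia.
by rewrite -(subnK (_ : (m <= socle_deg - i.*2)%N)); [rewrite exprD -mulrA lx0 mulr0|lia].
Qed.

Lemma mcoeffMX_compl (G : P) (u v top : 'X_{1..n}) : (u <= top)%MM -> (v <= top)%MM ->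
  (G * 'X_[top - v])@_(top - u) = (G * 'X_[u])@_v.
Proof.
move=> /mnm_lepP ut /mnm_lepP vt; case: (boolP (u <= v)%MM) => uv.
  have -> : (top - u = (top - v) + (v - u))%MM.
    apply/mnmP => i; rewrite mnmDE !mnmBE.
    have := mnm_lepP uv i; have := ut i; have := vt i; lia.
  by rewrite mcoeffMX -[in RHS](submK uv) addmC mcoeffMX.
rewrite !mcoeffMX_eq0 //; apply: contra uv => /mnm_lepP h; apply/mnm_lepP => i.
by have := h i; rewrite !mnmBE; have := ut i; have := vt i; lia.
Qed.

(** The degree bound makes the ambient type finite and loses no monomial that is nonzero in the
    quotient. *)
Definition basis_mons e : {set 'X_{1..n < socle_deg.+1}} :=
  [set m : 'X_{1..n < socle_deg.+1} | (mdeg m == e) && [forall i, m i < d i]%N].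

Lemma basis_monsP e (m : 'X_{1..n}) : mdeg m = e -> (forall i, m i < d i)%N ->
  exists j : 'I_#|basis_mons e|, m = enum_val j :> 'X_{1..n}.
Proof.
move=> me md; have mD : (mdeg m < socle_deg.+1)%N by rewrite ltnS mdeg_le_socle.
have mB : BMultinom mD \in basis_mons e.
  by rewrite inE /= me eqxx; apply/forallP.
by exists (enum_rank_in mB (BMultinom mD)); rewrite enum_rankK_in.
Qed.

Lemma basis_mons_enum e (j : 'I_#|basis_mons e|) (m := enum_val j : 'X_{1..n < socle_deg.+1}) :
  mdeg m = e /\ (forall i, m i < d i)%N.
Proof. by have := enum_valP j; rewrite inE => /andP[/eqP -> /forallP]. Qed.

(* The matrix of multiplication by l^m from A_i to A_(i+m) in the monomial bases
   is, up to complementing exponents, the transpose of the one from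
   A_(D-i-m) to A_(D-i); so injectivity of the latter is surjectivity of the former. *)
Lemma centered_lefschetz_surj l i m z : deg 1 l -> centered_lefschetz l ->
  (socle_deg < i.*2 + m)%N -> deg (i + m) z -> exists2 x, deg i x & l ^+ m * x = z.
Proof.
move=> [g hg ->] cl im zim.
case: (ltnP socle_deg (i + m)) => Dim.
  by exists 0; [exact: deg0|rewrite mulr0 (deg_gt_socle Dim zim)].
case: zim => h hh ->.
have hgm : g ^+ m \is m.-homog by have := dhomogMn m hg; rewrite mul1n.
pose top : 'X_{1..n} := [multinom (d j).-1 | j < n].
have letop (w : 'X_{1..n}) : (forall j, w j < d j)%N -> (w <= top)%MM.
  by move=> wd; apply/mnm_lepP => j; rewrite mnmE; have := wd j; lia.
have dt : mdeg top = socle_deg by rewrite mdegE; apply: eq_bigr => j _; rewrite mnmE.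
have degcompl (w : 'X_{1..n}) : (w <= top)%MM -> mdeg (top - w) = (socle_deg - mdeg w)%N.
  by move=> wt; rewrite -dt -{2}(submK wt) mdegD addnK.
have topd (w : 'X_{1..n}) j : ((top - w)%MM j < d j)%N.
  by rewrite mnmBE mnmE; have := hd j; lia.
pose M := \matrix_(u < #|basis_mons i|, v < #|basis_mons (i + m)|)
  (g ^+ m * 'X_[enum_val u])@_(enum_val v).
have : row_free M^T.
  rewrite -kermx_eq0; apply/rowV0P => c /sub_kermxP /rowP cM.
  (* A kernel vector of the transpose gives y in the complementary degree with l^m y = 0. *)
  pose y := \sum_(v < #|basis_mons (i + m)|) c 0 v *: 'X_[top - enum_val v].
  have hy : y \is (socle_deg - (i + m)).-homog.
    apply: rpred_sum => v _; apply: rpredZ; rewrite dhomogX /= degcompl.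
      by have [-> _] := basis_mons_enum v.
    by apply: letop; have [] := basis_mons_enum v.
  have y0 : toA y = 0.
    apply: (centered_lefschetz_inj (m := m) cl _ (deg_toA hy)); first by lia.
    rewrite -rmorphXn -rmorphM; apply/toA_eq0 => w wd.
    case: (eqVneq (mdeg w) (m + (socle_deg - (i + m)))%N) => dw; last first.
      exact: dhomog_nemf_coeff (dhomogM hgm hy) dw.
    have wt := letop _ wd.
    have dtw : mdeg (top - w) = i by rewrite degcompl // dw; lia.
    have [u eu] := basis_monsP dtw (topd w).
    have -> : w = (top - enum_val u)%MM.
      by rewrite -eu; apply/mnmP => j; rewrite !mnmBE; have /mnm_lepP/(_ j) := wt; lia.
    have := cM u; rewrite !mxE => cu; rewrite -[RHS]cu mulr_sumr raddf_sum /=.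
    apply: eq_bigr => v _; rewrite !mxE -scalerAr mcoeffZ mcoeffMX_compl //.
      by rewrite -eu lem_subr.
    by apply: letop; have [] := basis_mons_enum v.
  apply/rowP => v; rewrite mxE; move/toA_eq0: y0 => /(_ (top - enum_val v)%MM (topd _)).
  have [dv lv] := basis_mons_enum v; have {}lv := letop _ lv.
  rewrite raddf_sum (bigD1 v) //= mcoeffZ mcoeffX eqxx mulr1 big1 ?addr0 //.
  move=> v' vv'; rewrite mcoeffZ mcoeffX; case: eqP => [e|]; last by rewrite mulr0.
  case/eqP: vv'; apply/enum_val_inj/eqP; rewrite bmeqP; apply/eqP/mnmP => j.
  have [_ lv'] := basis_mons_enum v'; have {}lv' := letop _ lv'.
  have /mnmP/(_ j) := e; rewrite !mnmBE.
  by have /mnm_lepP/(_ j) := lv; have /mnm_lepP/(_ j) := lv'; lia.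
rewrite /row_free mxrank_tr -[_ == _]/(row_full M) => /row_fullP[B BM].
pose c := \row_v h@_(enum_val v : 'X_{1..n < socle_deg.+1}) *m B.
have cM : c *m M = \row_v h@_(enum_val v : 'X_{1..n < socle_deg.+1}).
  by rewrite -mulmxA BM mulmx1.
pose x := \sum_(u < #|basis_mons i|) c 0 u *: 'X_[enum_val u : 'X_{1..n < socle_deg.+1}] : P.
have hx : x \is i.-homog.
  apply: rpred_sum => u _; apply: rpredZ; rewrite dhomogX /=.
  by have [-> _] := basis_mons_enum u.
exists (toA x); first exact: deg_toA.
apply/eqP; rewrite -subr_eq0; apply/eqP.
rewrite -[\pi g]/(toA g) -[\pi h]/(toA h) -rmorphXn -rmorphM -rmorphB; apply/toA_eq0 => w wd.
case: (eqVneq (mdeg w) (i + m)%N) => dw; last first.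
  have hd' : g ^+ m * x - h \is (i + m).-homog.
    by rewrite rpredB // addnC dhomogM.
  exact: dhomog_nemf_coeff hd' dw.
have [v ->] := basis_monsP dw wd.
rewrite mcoeffB; apply/eqP; rewrite subr_eq0; apply/eqP.
have /rowP/(_ v) := cM; rewrite !mxE => <-; rewrite mulr_sumr raddf_sum /=.
by apply: eq_bigr => u _; rewrite !mxE -scalerAr mcoeffZ.
Qed.

Lemma centered_strong_lefschetz l : deg 1 l -> centered_lefschetz l -> strong_lefschetz deg.
Proof.
move=> l1 cl; exists l => // i m m1; case: (leqP (i.*2 + m) socle_deg) => im.
  left=> x y xi yi e; apply/eqP; rewrite -subr_eq0; apply/eqP.
  apply: (centered_lefschetz_inj cl im); first exact/degD/degN.
  by rewrite mulrBr e subrr.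
by right=> z zim; apply: centered_lefschetz_surj.
Qed.

End Quotient.

(** * Necessity *)

Section Nilpotent.

Variables (R : comNzRingType) (z y v : R) (a b : nat).
Hypotheses (za : z ^+ a.+1 * v = 0) (yb : y ^+ b.+1 * v = 0).

Lemma nilpotent_addr k : (a + b < k)%N -> (z + y) ^+ k * v = 0.
Proof.
move=> abk; rewrite addrC exprDn mulr_suml big1 // => u _.
rewrite mulrnAl [_ * z ^+ _]mulrC (monomial_vanish za yb) ?mul0rn //.
by have := ltn_ord u; lia.
Qed.

Lemma top_power_addr :
  (z + y) ^+ (a + b) * v = 'C(a + b, a)%:R * (z ^+ a * y ^+ b * v).
Proof.
have ha : (a < (a + b).+1)%N by lia.
rewrite addrC exprDn mulr_suml (bigD1 (Ordinal ha)) //= big1 ?addr0.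
  by rewrite mulr_natl addKn [y ^+ _ * _]mulrC mulrnAl.
move=> u ua; rewrite mulrnAl [_ * z ^+ _]mulrC (monomial_vanish za yb) ?mul0rn //.
have := ltn_ord u; have : (u : nat) <> a by move=> e; case/eqP: ua; apply/val_inj.
lia.
Qed.

End Nilpotent.

Section Necessity.

Variables (K : fieldType) (p : nat) (n : nat) (d : 'I_n -> nat).
Hypothesis (hp : p \in [pchar K]).
Hypothesis hd : forall i, (2 <= d i)%N.

Local Notation A := (monomial_ci K hd).
Local Notation deg := (@monomial_ci_graded K n d hd).
Local Notation D := (socle_deg d).

Lemma deg_binary_form z y v i g (c : 'rV[K]_i.+1) : deg 1 z -> deg 1 y -> deg g v ->
  deg (i + g) (binary_form (scalar hd) z y v c).
Proof.
move=> dz dy dv; apply: deg_sum => s _; apply: degZ; apply: degM => //.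
have si : (1 * s + 1 * (i - s) = i)%N by have := ltn_ord s; lia.
by rewrite -[X in deg X _]si; apply: degM; apply: degX => //; apply: degD.
Qed.

Section Strings.

Variables (z y w v : A) (a b g J : nat).
Hypotheses (a0 : (0 < a)%N) (b0 : (0 < b)%N).
Hypotheses (cl : centered_lefschetz (z + y + w)) (dz : deg 1 z) (dy : deg 1 y).
Hypotheses (dv : deg g v) (v0 : v != 0).
Hypotheses (za : z ^+ a * v = 0) (yb : y ^+ b * v = 0) (wJ : w ^+ J.+1 = 0).
Hypothesis eD : (a.-1 + b.-1 + J + g.*2 = D)%N.

(** l^(D-2g) v is a multiple of z^(a-1) y^(b-1) w^J v, all other terms being zero for degree
    reasons. Were z^(a-1) y^(b-1) v zero, v would vanish. *)
Lemma string_socle : z ^+ a.-1 * y ^+ b.-1 * v != 0.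
Proof.
have za' : z ^+ a.-1.+1 * v = 0 by rewrite prednK.
have yb' : y ^+ b.-1.+1 * v = 0 by rewrite prednK.
apply: contra v0 => /eqP soc; apply/eqP; apply: (cl (i := g)) => //; first by lia.
have -> : (D - g.*2 = (a.-1 + b.-1) + J)%N by lia.
rewrite top_power_addr ?(nilpotent_addr za' yb') //; last by rewrite wJ mul0r.
by rewrite [_ * w ^+ J * v]mulrAC (top_power_addr za' yb') soc mulr0 mul0r mulr0.
Qed.

(* v generates a copy of K[z, y] / (z^a, y^b) inside A, centred at D / 2. *)
Lemma string_pair_good : pair_good p a b.
Proof.
apply: (lefschetz_pair_good hp (phi := @scalar K n d hd) a0 b0 za yb string_socle) => i c iab h.
apply: (cl (i := (g + i)%N)); first by lia.
  by rewrite addnC; apply: deg_binary_form.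
have -> : (D - (g + i).*2 = (a + b - i.+1.*2) + J)%N by lia.
(* If (z+y)^k kills the form and w^(J+1) = 0, then l^(k+J) kills it as well. *)
case: (a + b - i.+1.*2)%N h => [|k] h.
  by move: h; rewrite mul1r => ->; rewrite mulr0.
by apply: (nilpotent_addr h (b := J)); rewrite ?wJ ?mul0r //; lia.
Qed.

End Strings.

Variable alpha : 'I_n -> K.
Let x i : A := scalar hd (alpha i) * toA hd 'X_i.
Hypothesis cl : centered_lefschetz (\sum_i x i).

Let deg_x i : deg 1 (x i).
Proof. by apply/degZ/deg_var. Qed.

Let deg_xs (S : {set 'I_n}) : deg 1 (\sum_(i in S) x i).
Proof. exact: deg_sum. Qed.

Let x_nilp i : x i ^+ d i = 0.
Proof. by rewrite exprMn var_nilp mulr0. Qed.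

Let xs_nilp (S : {set 'I_n}) : (\sum_(i in S) x i) ^+ (\sum_(i in S) (d i).-1).+1 = 0.
Proof.
elim/big_rec2: _ => [|i s k _ IH]; first by rewrite expr1.
rewrite -[LHS]mulr1; apply: (nilpotent_addr (a := (d i).-1) (b := k)) => //.
  by rewrite mulr1 prednK ?x_nilp //; have := hd i; lia.
by rewrite mulr1 IH.
Qed.

(** The case v = 1: the sum of the variables in S acts as a single variable of exponent 1 plus the
    sum of the d_i - 1. *)
Lemma pair_good_set (S : {set 'I_n}) j : j \notin S ->
  pair_good p (\sum_(i in S) (d i).-1).+1 (d j).
Proof.
move=> jS; have dj := hd j.
have split3 (V : nmodType) (F : 'I_n -> V) :
    \sum_i F i = \sum_(i in S) F i + F j + \sum_(i in ~: (j |: S)) F i.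
  rewrite (bigID (mem S)) /= -addrA; congr (_ + _).
  rewrite (bigD1 j) //=; congr (_ + _); apply: eq_bigl => i.
  by rewrite !inE negb_or andbC.
apply: (@string_pair_good (\sum_(i in S) x i) (x j) (\sum_(i in ~: (j |: S)) x i) 1 _ (d j) 0 
   (\sum_(i in ~: (j |: S)) (d i).-1)) => //.
- exact: ltnW.
- by rewrite -split3.
- exact: deg1.
- exact: oner_neq0.
- by rewrite xs_nilp mul0r.
- by rewrite x_nilp mul0r.
- rewrite addn0; exact: (esym (split3 nat (fun i => (d i).-1))).
Qed.

Lemma pair_good_distinct i j : i != j -> pair_good p (d i) (d j).
Proof.
move=> ij; have := @pair_good_set [set i] j; rewrite big_set1 inE eq_sym prednK; last first.
  by have := hd i; lia.
exact.
Qed.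

(** Induction on S: by [pair_good_small], each further variable keeps the sum below p. *)
Lemma sum_small_lt (S : {set 'I_n}) : (forall i, i \in S -> (d i <= p)%N) ->
  (\sum_(i in S) (d i).-1 < p)%N.
Proof.
have p1 : (1 < p)%N := prime_gt1 (pcharf_prime hp).
move: {2}#|S| (leqnn #|S|) => k; elim: k S => [|k IH] S.
  by rewrite leqn0 cards_eq0 => /eqP-> _; rewrite big_set0; lia.
move=> cS hS; case: (set_0Vmem S) => [->|[j jS]]; first by rewrite big_set0; lia.
rewrite (big_setD1 j) //=; have : (\sum_(i in S :\ j) (d i).-1 < p)%N.
  by apply: IH => [|i /setD1P[_ /hS]//]; move: cS; rewrite (cardsD1 j) jS.
have := @pair_good_set (S :\ j) j; rewrite !inE eqxx => /(_ isT).
move: (\sum_(i in _) _)%N => s pg sp; have := hd j; have := hS j jS => dp dj.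
case: (posnP s) => [->|s0]; first by lia.
by have := @pair_good_small p s.+1 (d j) p1; move/(_ _ _ pg); lia.
Qed.

(** A form f of suitable degree g in x_1 and x_2 is killed by a power of x_1 + x_2 with exponent
    divisible by p. The string through f then pairs this exponent with d_3, against
    [dvdn_not_pair_good]. *)
Lemma no_large_triple i1 i2 i3 : (2 < p)%N -> i1 != i2 -> i1 != i3 -> i2 != i3 ->
  (p <= d i1)%N -> (p <= d i2)%N -> False.
Proof.
move=> p2 i12 i13 i23 p1 pd2.
have op : odd p by have := pcharf_prime hp; move/even_prime; lia.
have dd1 := hd i1; have dd2 := hd i2; have dd3 := hd i3.
pose s := (d i1 + d i2 - 1)%N.
(* g is s/2 modulo p, as (p+1)/2 inverts 2. Being below p, it is an admissible degree for a
   primitive form. *)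
pose g := ((s * (p./2).+1) %% p)%N.
have gp : (g < p)%N by rewrite ltn_pmod; lia.
have sg : (p %| s - g.*2)%N.
  rewrite -eqn_mod_dvd; last by rewrite /s; lia.
  rewrite -muln2 /g modnMml -mulnA.
  have -> : ((p./2).+1 * 2 = p + 1)%N by lia.
  by rewrite mulnDr muln1 modnMDl.
have split4 (V : nmodType) (F : 'I_n -> V) :
    \sum_i F i = F i1 + F i2 + F i3 + \sum_(i in ~: [set i1; i2; i3]) F i.
  rewrite (bigD1 i1) //= -!addrA; congr (_ + _).
  rewrite (bigD1 i2) 1?eq_sym //=; congr (_ + _).
  rewrite (bigD1 i3) /=; last by rewrite ![i3 == _]eq_sym i13 i23.
  congr (_ + _); apply: eq_bigl => i.
  by rewrite !inE !negb_or.
have eD : D = ((d i1).-1 + (d i2).-1 + (d i3).-1 +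
    \sum_(i in ~: [set i1; i2; i3]) (d i).-1)%N := split4 nat (fun i => (d i).-1).
pose w := \sum_(i in ~: [set i1; i2; i3]) x i.
have cl1 : centered_lefschetz (x i1 + x i2 + (x i3 + w)) by rewrite addrA -split4.
have cl2 : centered_lefschetz ((x i1 + x i2) + x i3 + w) by rewrite -split4.
have gm : (g < minn (d i1) (d i2))%N by lia.
have x1 : x i1 ^+ d i1 * 1 = 0 by rewrite x_nilp mul0r.
have x2 : x i2 ^+ d i2 * 1 = 0 by rewrite x_nilp mul0r.
have w3 : (x i3 + w) ^+ ((d i3).-1 + \sum_(i in ~: [set i1; i2; i3]) (d i).-1).+1 = 0.
  rewrite -[LHS]mulr1; apply: (nilpotent_addr (a := (d i3).-1)
    (b := (\sum_(i in ~: [set i1; i2; i3]) (d i).-1)%N)) => //; rewrite mulr1 ?xs_nilp //.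
  by rewrite prednK ?x_nilp //; lia.
have soc : x i1 ^+ (d i1).-1 * x i2 ^+ (d i2).-1 * 1 != 0.
  apply: (string_socle (w := x i3 + w) (g := 0)
    (J := ((d i3).-1 + \sum_(i in ~: [set i1; i2; i3]) (d i).-1)%N)) => //; try lia.
  - exact: deg1.
  - exact: oner_neq0.
have [c f0 fe] := primitive_binary_form (scalar hd) (ltnW dd1) (ltnW dd2) x1 x2 soc gm.
set f := binary_form _ _ _ _ _ in f0 fe.
have df : deg g f.
  by rewrite -[g]addn0; apply: deg_binary_form => //; apply: deg1.
have e0 : (0 < s - g.*2)%N by rewrite /s; lia.
apply: (@dvdn_not_pair_good p (s - g.*2) (d i3)) => //.
apply: (@string_pair_good (x i1 + x i2) (x i3) w f _ _ g
   (\sum_(i in ~: [set i1; i2; i3]) (d i).-1)) => //.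
- exact: ltnW.
- exact: degD.
- by move: fe; rewrite /s -subnDA add1n.
- by rewrite x_nilp mul0r.
- exact: xs_nilp.
- rewrite eD /s; clear - gp p1 pd2 dd3 dd1 dd2.
  move: (\sum_(i in _) _)%N g gp => J g; lia.
Qed.

End Necessity.

(** * Sufficiency *)

Section Lowering.

Variables (K : fieldType) (n : nat) (d : 'I_n -> nat).
Implicit Types f : {mpoly K[n]}.

Local Notation D := (socle_deg d).

Definition sum_var : {mpoly K[n]} := \sum_i 'X_i.
Local Notation L := sum_var.

(** The sl_2 lowering operator on the tensor product of the K[x_j]/(x_j^(d_j)): in each variable x^m
    goes to m (d_j - m) x^(m-1). The factor vanishes at m = d_j, so the ideal is preserved. *)
Definition lowering f : {mpoly K[n]} :=
  \sum_j ((d j).-1%:R *: f^`M(j) - 'X_j * f^`M(j)^`M(j)).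

Lemma mcoeff_mulXderiv f j m : ('X_j * f^`M(j))@_m = f@_m *+ m j.
Proof.
rewrite mulrC; case: (boolP (U_(j) <= m)%MM) => [jm|jm].
  rewrite -{1}(submK jm) addmC mcoeffMX mcoeff_deriv submK // mnmBE mnm1E eqxx subn1.
  by rewrite prednK //; move: jm; rewrite lep1mP; lia.
by rewrite mcoeffMX_eq0 //; move: jm; rewrite lep1mP negbK => /eqP->; rewrite mulr0n.
Qed.

Lemma mcoeff_lowering f m : (lowering f)@_m =
  \sum_j f@_(m + U_(j)) * ((m j).+1%:R * ((d j).-1%:R - (m j)%:R)).
Proof.
rewrite raddf_sum; apply: eq_bigr => j _ /=.
rewrite mcoeffB mcoeffZ mcoeff_mulXderiv mcoeff_deriv.
move: (f@_ _) => c; rewrite -(mulr_natr c) -(mulr_natr (c * _)); ring.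
Qed.

Lemma lowering_vanish f : vanish d f -> vanish d (lowering f).
Proof.
move=> hf m md; rewrite mcoeff_lowering big1 // => j _.
case: (ltnP (m j).+1 (d j)) => mj.
  rewrite hf ?mul0r // => i; rewrite mnmDE mnm1E; case: eqP => [<-|_]; first by rewrite addn1.
  by rewrite addn0.
have -> : m j = (d j).-1 by have := md j; lia.
by rewrite subrr !mulr0.
Qed.

Lemma lowering_homog i f : f \is i.+1.-homog -> lowering f \is i.-homog.
Proof.
move=> hf; apply/dhomogP => m; apply: contraTeq => mi.
rewrite -mcoeff_eq0 mcoeff_lowering big1 // => j _.
by rewrite (dhomog_nemf_coeff hf) ?mul0r //= mdegD mdeg1 addn1 eqSS.
Qed.

Lemma lowering_homog0 f : f \is 0.-homog -> lowering f = 0.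
Proof.
move=> hf; apply/mpolyP => m; rewrite mcoeff_lowering mcoeff0 big1 // => j _.
by rewrite (dhomog_nemf_coeff hf) ?mul0r //= mdegD mdeg1 addn1.
Qed.

Lemma euler_homog i f : f \is i.-homog -> \sum_j 'X_j * f^`M(j) = i%:R *: f.
Proof.
move=> hf; apply/mpolyP => m; rewrite raddf_sum mcoeffZ /=.
under eq_bigr do rewrite mcoeff_mulXderiv -mulr_natr.
rewrite -mulr_sumr -natr_sum -mdegE mulrC.
by case: (eqVneq (mdeg m) i) => [->|/(dhomog_nemf_coeff hf)->]; rewrite ?mulr0.
Qed.

(** The sl_2 commutator relation: on degree i the weight is D - 2i. *)
Lemma lowering_sum_var i f : f \is i.-homog ->
  lowering (L * f) = L * lowering f + (D%:R - i.*2%:R) *: f.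
Proof.
move=> hf.
have dL j : L^`M(j) = 1.
  rewrite raddf_sum (bigD1 j) //= mderivX mnm1E eqxx scale1r.
  have -> : (U_(j) - U_(j))%MM = 0%MM by apply/mnmP => i'; rewrite mnmBE subnn mnm0E.
  rewrite mpolyX0.
  rewrite big1 ?addr0 // => k kj; rewrite mderivX mnm1E (negbTE kj) scale0r //.
have e1 j : (L * f)^`M(j) = f + L * f^`M(j) by rewrite mderivM dL mul1r.
have e2 j : (L * f)^`M(j)^`M(j) = f^`M(j) *+ 2 + L * f^`M(j)^`M(j).
  by rewrite e1 mderivD mderivM dL mul1r mulr2n addrA.
rewrite /lowering; under eq_bigr do rewrite e2 e1.
rewrite mulr_sumr scalerBl -muln2 natrM mulrC -scalerA -(euler_homog hf).
rewrite natr_sum scaler_suml scaler_sumr -sumrB -big_split /=; apply: eq_bigr => j _.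
by rewrite -!mul_mpolyC; ring.
Qed.

Lemma lowering_sum_varX i f k : f \is i.-homog ->
  lowering (L ^+ k * f) =
  L ^+ k * lowering f + (k%:R * (D%:R - (i.*2)%:R - k%:R + 1)) *: (L ^+ k.-1 * f).
Proof.
move=> hf; have hL : L \is 1.-homog.
  by apply: rpred_sum => j _; rewrite dhomogX /= mdeg1.
elim: k => [|k IH]; first by rewrite !mul1r mul0r scale0r addr0.
have hk : L ^+ k * f \is (k + i).-homog.
  by apply: dhomogM => //; have := dhomogMn k hL; rewrite mul1n.
rewrite exprS -mulrA (lowering_sum_var hk) IH mulrDr mulrA -exprS -addrA; congr (_ + _).
rewrite -scalerAr; case: k {hk IH} => [|k] /=.
  rewrite !mul1r mul0r scale0r add0r add0n; congr (_ *: _); ring.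
rewrite mulrA -exprS -scalerDl; congr (_ *: _).
by rewrite -!muln2; ring.
Qed.

(* As the falling factor k (D - 2i - k + 1) is invertible, L^k f = 0 descends to
   L^(k-1) f = 0 once the lowered form, of smaller degree, has been dealt with. *)
Lemma small_socle_inj p i k f : p \in [pchar K] -> (D < p)%N -> f \is i.-homog ->
  (k + i.*2 <= D)%N -> vanish d (L ^+ k * f) -> vanish d f.
Proof.
move=> hp Dp; have unit_nat m : (0 < m <= D)%N -> m%:R != 0 :> K.
  move=> /andP[m0 mD]; rewrite -(dvdn_pcharf hp); apply/negP => /(dvdn_leq m0).
  by rewrite leqNgt (leq_ltn_trans mD Dp).
have step e k' g : (k'.+1 + e.*2 <= D)%N ->
    vanish d ((k'.+1%:R * (D%:R - (e.*2)%:R - k'.+1%:R + 1)) *: (L ^+ k' * g)) ->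
    vanish d (L ^+ k' * g).
  move=> kD; have -> : k'.+1%:R * (D%:R - (e.*2)%:R - k'.+1%:R + 1) =
      (k'.+1 * (D - e.*2 - k'))%:R :> K.
    by rewrite natrM -subnDA natrB ?natrD -?natr1; [ring|lia].
  move=> h m md; have := h m md; rewrite mcoeffZ => /eqP; rewrite mulf_eq0.
  have nz : (k'.+1 * (D - e.*2 - k'))%:R != 0 :> K.
    by rewrite natrM mulf_neq0 ?unit_nat //; lia.
  by rewrite (negbTE nz) => /eqP.
elim: i k f => [|i IHi] k f hf; (elim: k => [|k IHk] kD h; first by rewrite mul1r in h).
all: apply: IHk; first by lia.
  apply: (step 0%N) => //; have := lowering_vanish h.
  by rewrite (lowering_sum_varX _ hf) lowering_homog0 // mulr0 add0r.
apply: (step i.+1) => //; have hl := lowering_vanish h.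
rewrite (lowering_sum_varX _ hf) in hl.
(* Multiplying the lowered relation by L and subtracting a multiple of [h] shows that L^(k+2) kills
   the lowered form, whose degree is smaller. *)
have low : vanish d (lowering f).
  apply: (IHi k.+2); [exact: lowering_homog|by lia|].
  have := vanishM L hl; rewrite mulrDl -scalerAl ![_ * L]mulrC !mulrA -!exprS => hl2.
  have := vanishD hl2 (vanishN (vanishZ (k.+1%:R * (D%:R - (i.+1.*2)%:R - k.+1%:R + 1)) h)).
  by rewrite addrK.
have := vanishD hl (vanishN (vanishM (L ^+ k.+1) low)).
by rewrite [lowering f * _]mulrC addrC addKr.
Qed.

End Lowering.

Section MixedCase.

Variables (K : fieldType) (p n : nat) (d : 'I_n -> nat) (j : 'I_n) (t : nat).
Hypothesis hp : p \in [pchar K].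
Implicit Types f : {mpoly K[n]}.
Local Notation L := (sum_var K n).
Local Notation DB := (\sum_(i < n | i != j) (d i).-1)%N.

Variable c : nat.
Hypotheses (d0 : forall i, (0 < d i)%N) (dj : d j = (t * p + c)%N) (t0 : (0 < t)%N).
Hypotheses (dp : forall i, i != j -> (d i < p)%N).
Hypotheses (cDB : (DB <= c)%N) (cp : (c + DB <= p)%N) (DB0 : (0 < DB)%N).

Let d' i := if i == j then c else d i.

Let socle_d : socle_deg d = (DB + (t * p + c).-1)%N.
Proof. by rewrite /socle_deg (bigD1 j) //= dj addnC. Qed.

Let socle_d' : socle_deg d' = (DB + c.-1)%N.
Proof.
rewrite /socle_deg (bigD1 j) //= {1}/d' eqxx addnC; congr addn.
by apply: eq_bigr => i ij; rewrite /d' (negbTE ij).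
Qed.

Lemma vanish_divXn s f : d j = (s + c)%N -> vanish d ('X_j ^+ s * f) -> vanish d' f.
Proof.
move=> ds h m md; rewrite -(mcoeffMX f (U_(j) *+ s) m) mulrC -mpolyXn; apply: h => i.
rewrite mnmDE mulmnE mnm1E; have := md i; rewrite /d'.
case: (eqVneq i j) => [->|_ mi]; last by rewrite mul0n.
by rewrite mul1n ds ltn_add2l.
Qed.

(* Since d_i < p for i <> j, the Frobenius gives L^p = X_j^p modulo the ideal. *)
Lemma sum_varXp s : exists2 g, vanish d g & L ^+ (s * p) = 'X_j ^+ (s * p) + g.
Proof.
elim: s => [|s [g hg e]]; first by exists 0; [exact: vanish0|rewrite mul0n !expr0 addr0].
have chP : p \in [pchar {mpoly K[n]}].
  by rewrite (rmorph_pchar (@mpolyC n K)).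
have eLp : L ^+ p = 'X_j ^+ p + \sum_(i < n | i != j) 'X_i ^+ p.
  rewrite /sum_var -(pFrobenius_autE chP) raddf_sum (bigD1 j) //=.

have hz : vanish d (\sum_(i < n | i != j) 'X_i ^+ p : {mpoly K[n]}).
  apply: vanish_sum => i ij; rewrite mpolyXn; apply: (@vanish_X _ _ _ _ i).
  by rewrite mulmnE mnm1E eqxx mul1n ltnW // dp.
exists ('X_j ^+ p * g + (\sum_(i < n | i != j) 'X_i ^+ p) * ('X_j ^+ (s * p) + g)).
  by apply: vanishD; [rewrite mulrC|]; apply: vanishM.
by rewrite mulSn exprD e eLp mulrDl mulrDr -exprD addrA.
Qed.

Lemma mcoeff_sum_varX N : (L ^+ N)@_(U_(j) *+ N) = 1.
Proof.
elim: N => [|N IH]; first by rewrite mulm0n mcoeffC eqxx mulr1.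
rewrite exprSr {2}/sum_var (bigD1 j) //= mulrDr mcoeffD mulmS mcoeffMX IH mulr_sumr raddf_sum.
rewrite big1 ?addr0 // => i ij /=; rewrite mcoeffMX_eq0 // lep1mP negbK.
by rewrite mnmDE mulmnE mnm1E [j == i]eq_sym (negbTE ij).
Qed.

(** L^(tp) acts as X_j^(tp), and cancelling it lowers the exponent d_j to c. The new socle degree DB
    + c - 1 is below p, so [small_socle_inj] applies. *)
Lemma mixed_inj i f : (i <= DB)%N -> f \is i.-homog ->
  vanish d (L ^+ (socle_deg d - i.*2) * f) -> vanish d f.
Proof.
move=> iDB hf; rewrite socle_d => h.
have key g : vanish d (L ^+ (t * p) * g) -> vanish d' g.
  have [r hr ->] := sum_varXp t; rewrite mulrDl => hg.
  apply: (@vanish_divXn (t * p)) => //.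
  by have := vanishD hg (vanishN (vanishM g hr)); rewrite addrK.
have mj (m : 'X_{1..n}) : (m j <= mdeg m)%N by rewrite mdegE (bigD1 j) //= leq_addr.
case: (leqP i.*2 (DB + c.-1)) => hi.
  have e : (DB + (t * p + c).-1 - i.*2 = t * p + (DB + c.-1 - i.*2))%N by lia.
  rewrite e exprD -mulrA in h; move/key: h.
  rewrite -socle_d' => /(small_socle_inj hp _ hf) h.
  have {}h : vanish d' f by apply: h; rewrite socle_d'; lia.
  move=> m md; case: (ltnP (m j) c) => mc.
    by apply: h => l; rewrite /d'; case: eqP => [->|].
  apply: (dhomog_nemf_coeff hf); rewrite neq_ltn; apply/orP; right => /=.
  by apply: leq_trans (mj m); lia.
(* The remaining boundary case i = DB = c: the available power is only L^(tp-1), one short of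
   L^(tp). There f reduces to a multiple of X_j^c, detected by the coefficient at X_j^(tp-1+c). *)
have [ei eD] : i = c /\ DB = c.
  by move: DB hi iDB cDB DB0 => S; lia.
have tp0 : (0 < t * p)%N by rewrite muln_gt0 t0 prime_gt0 // (pcharf_prime hp).
have {}h : vanish d (L ^+ (t * p).-1 * f).
  by have -> : (t * p).-1 = (DB + (t * p + c).-1 - i.*2)%N by lia.
have hd' : vanish d' f.
  by apply: key; rewrite -(prednK tp0) exprSr -mulrA [L * f]mulrC mulrA; apply: vanishM.
have mjc (m : 'X_{1..n}) : (forall l, m l < d l)%N -> f@_m != 0 -> m = (U_(j) *+ c)%MM.
  move=> md fm; have dm : mdeg m = c.
    by apply/eqP; rewrite -ei; apply: contraR fm => /(dhomog_nemf_coeff hf)->.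
  have mc : (c <= m j)%N.
    rewrite leqNgt; apply: contraR fm => /negbNE mc; rewrite hd' // => l.
    by rewrite /d'; case: eqP => [->|].
  have mle : (U_(j) *+ c <= m)%MM.
    by apply/mnm_lepP => l; rewrite mulmnE mnm1E; case: eqP => [<-|]; rewrite ?mul1n.
  have : (m - U_(j) *+ c)%MM = 0%MM.
    apply/eqP; rewrite -mdeg_eq0 -(eqn_add2r (mdeg (U_(j) *+ c))) -mdegD submK //.
    by rewrite mdegMn mdeg1 mul1n dm.
  by rewrite -{2}(submK mle) => ->; rewrite add0m.
pose b := f@_(U_(j) *+ c).
have hr : vanish d (f - b *: 'X_[U_(j) *+ c]).
  move=> m md; rewrite mcoeffB mcoeffZ mcoeffX; case: eqP => [<-|ne].
    by rewrite mulr1 subrr.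
  rewrite mulr0 subr0; apply/eqP; apply: contraT => fm.
  by case: ne; rewrite [RHS](mjc m).
have hb : vanish d (b *: (L ^+ (t * p).-1 * 'X_[U_(j) *+ c])).
  have := vanishD h (vanishN (vanishM (L ^+ (t * p).-1) hr)).
  by rewrite mulrBl [f * _]mulrC opprB addrC subrK -scalerAl [_ * L ^+ _]mulrC.
have b0 : b = 0.
  rewrite -(hb (U_(j) *+ c + U_(j) *+ (t * p).-1)%MM) => [|l].
    by rewrite mcoeffZ mcoeffMX mcoeff_sum_varX mulr1.
  rewrite mnmDE !mulmnE mnm1E; case: eqP => [<-|_]; last by rewrite !mul0n.
  by rewrite !mul1n dj; lia.
by move: hr; rewrite b0 scale0r subr0.
Qed.

End MixedCase.

(** The change of basis from monomials is inverse to the unitriangular Pascal matrix. *)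
Lemma binary_form_span (K : fieldType) (R : comNzRingType) (phi : {rmorphism K -> R})
    (z y v : R) i (e : nat -> K) :
  exists c : 'rV[K]_i.+1,
    \sum_(u < i.+1) phi (e u) * (z ^+ u * y ^+ (i - u) * v) = binary_form phi z y v c.
Proof.
pose B := binomial_mx K i.+1 0 0.
have uB : B \in unitmx by rewrite -row_free_unit binomial_mx_unitri.
pose c := (\row_u e u) *m invmx B; exists c.
have ec : c *m B = \row_u e u by rewrite mulmxKV.
rewrite -[RHS]mul1r -(expr0 (z + y)) mul_binary_form add0n.
apply: eq_bigr => u _; congr (phi _ * _).
have /rowP/(_ u) := ec; rewrite [RHS]mxE => <-; rewrite mxE.
by apply: eq_bigr => s _; rewrite [in X in _ * X = _]mxE.
Qed.

Section Sufficiency.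

Variables (K : fieldType) (n : nat) (d : 'I_n -> nat).
Hypothesis hd : forall i, (2 <= d i)%N.

Local Notation A := (monomial_ci K hd).
Local Notation deg := (@monomial_ci_graded K n d hd).
Local Notation D := (socle_deg d).
Local Notation l := (toA hd (sum_var K n)).

Lemma sum_var_homog : sum_var K n \is 1.-homog.
Proof. by apply: rpred_sum => j _; rewrite dhomogX /= mdeg1. Qed.

Lemma deg_sum_var : deg 1 l.
Proof. exact/deg_toA/sum_var_homog. Qed.

Section Base.

Variable j : 'I_n.
Local Notation DB := (\sum_(i < n | i != j) (d i).-1)%N.

(* Modulo L, a monomial can be rewritten with one factor X_j traded for the other
   variables; this stops once the exponents of the others exceed the socle. *)
Lemma sum_var_divides_X (m : 'X_{1..n}) : (DB < mdeg m)%N ->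
  exists2 w, deg (mdeg m).-1 w & toA hd 'X_[m] = l * w.
Proof.
pose dB (m : 'X_{1..n}) := (\sum_(i < n | i != j) m i)%N.
have split_deg (u : 'X_{1..n}) : (mdeg u = u j + dB u)%N by rewrite mdegE (bigD1 j).
(* The difference equals the exponent of X_j, which drops at each trade. *)
move: {2}(mdeg m - dB m)%N (leqnn (mdeg m - dB m)) => k.
elim: k m => [|k IH] m hk hm; (case: (boolP [exists i, (i != j) && (d i <= m i)%N]);
  [case/existsP=> i /andP[ij dm]; exists 0; [exact: deg0|];
   rewrite mulr0; apply/toA_eq0; exact: (@vanish_X _ _ _ _ i)|];
  rewrite negb_exists => /forallP hs).
all: have hdB : (dB m <= DB)%N by apply: leq_sum => i ij; have := hs i; rewrite ij /=; lia.
  by have := split_deg m; lia.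
have mj : (0 < m j)%N by have := split_deg m; lia.
have mU : (U_(j) <= m)%MM by rewrite lep1mP -lt0n.
pose m' := (m - U_(j))%MM.
have em : m = (m' + U_(j))%MM by rewrite submK.
have dm' : mdeg m' = (mdeg m).-1 by rewrite em mdegD mdeg1 addn1.
have next i : i != j -> exists2 w, deg (mdeg m).-1 w & toA hd 'X_[m' + U_(i)] = l * w.
  move=> ij; have e1 : mdeg (m' + U_(i)) = mdeg m by rewrite mdegD mdeg1 addn1 dm' prednK; lia.
  have e2 : dB (m' + U_(i))%MM = (dB m).+1.
    have e3 : dB m' = dB m.
      by apply: eq_bigr => i' i'j; rewrite mnmBE mnm1E eq_sym (negbTE i'j) subn0.
    rewrite -e3 /dB; under eq_bigr do rewrite mnmDE.
    rewrite big_split /= [X in (_ + X)%N](bigD1 i) //= mnm1E eqxx [X in (_ + (_ + X))%N]big1 ?addn0 ?addn1 //.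
    by move=> i' /andP[_ i'i]; rewrite mnm1E eq_sym (negbTE i'i).
  by rewrite -e1; apply: IH; rewrite ?e1 ?e2 //; lia.
have [w wd we] : exists2 w, deg (mdeg m).-1 w &
    \sum_(i < n | i != j) toA hd 'X_[m' + U_(i)] = l * w.
  elim/big_rec: _ => [|i s ij [w wd ->]]; first by exists 0; [exact: deg0|rewrite mulr0].
  have [w' wd' ->] := next i ij; exists (w' + w); [exact: degD|by rewrite mulrDr].
exists (toA hd 'X_[m'] - w).
  by apply: degD; [apply: deg_toA; rewrite dhomogX /= dm'|exact: degN].
rewrite mulrBr -we -rmorphM /sum_var mulr_suml (bigD1 j) //= rmorphD rmorph_sum /=.
under [X in _ + X - _]eq_bigr do rewrite -mpolyXD addmC.
by rewrite addrK -mpolyXD addmC -em.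
Qed.

Lemma sum_var_divides i x : (DB < i)%N -> deg i x -> exists2 w, deg i.-1 w & x = l * w.
Proof.
move=> hi [f hf ->]; rewrite -[\pi f]/(toA hd f) [f]mpolyE big_seq rmorph_sum /=.
elim/big_rec: _ => [|m s mf [w wd ->]]; first by exists 0; [exact: deg0|rewrite mulr0].
have mi : mdeg m = i := dhomog_mf hf mf.
have [|w' wd' e] := @sum_var_divides_X m; first by rewrite mi.
exists (scalar hd f@_m * w' + w).
  by apply: degD => //; apply: degZ; rewrite -mi.
by rewrite toAZ e mulrDr mulrCA.
Qed.

Lemma sum_var_divides_base t x : deg (DB + t) x -> exists2 w, deg DB w & x = l ^+ t * w.
Proof.
elim: t x => [|t IH] x; first by rewrite addn0; exists x; rewrite ?mul1r.
move=> /sum_var_divides[|w wd ->]; first by lia.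
rewrite addnS /= in wd; have [w' wd' ->] := IH w wd.
by exists w'; rewrite // mulrA -exprS.
Qed.

(** For i > DB an element of A_i is l^(i-DB) w with w of degree DB. If l^(D-2i) kills it, then
    l^(D-2DB) kills w. *)
Lemma centered_of_base : (DB.*2 <= D)%N ->
  (forall i x, (i <= DB)%N -> deg i x -> l ^+ (D - i.*2) * x = 0 -> x = 0) ->
  centered_lefschetz l.
Proof.
move=> hD h i x iD xi lx; case: (leqP i DB) => iDB; first exact: h lx.
have et : (DB + (i - DB) = i)%N by rewrite subnKC // ltnW.
move: xi; rewrite -et => /sum_var_divides_base[w wd ew].
rewrite ew mulrA -exprD in lx.
rewrite ew; suff -> : w = 0 by rewrite mulr0.
apply: (h DB) => //.
have -> : (D - DB.*2 = (i - DB) + ((D - i.*2) + (i - DB)))%N.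
  by move: DB (socle_deg d) hD iD iDB => S T; lia.
by rewrite exprD -mulrA lx mulr0.
Qed.

End Base.

Lemma centered_small_socle p : p \in [pchar K] -> (D < p)%N -> centered_lefschetz l.
Proof.
move=> hp Dp i x iD [f hf ->]; rewrite -[\pi f]/(toA hd f) -rmorphXn -rmorphM.
move/toA_eq0 => h; apply/toA_eq0.
by apply: (small_socle_inj hp Dp hf _ h); lia.
Qed.

Lemma centered_mixed p j : p \in [pchar K] -> (1 < n)%N -> (p <= d j)%N ->
  (forall i, i != j -> d i < p)%N ->
  (\sum_(i < n | i != j) (d i).-1 <= minn (d j %% p) (p - d j %% p))%N ->
  centered_lefschetz l.
Proof.
move=> hp n1 pj dp hS; have p0 := prime_gt0 (pcharf_prime hp).
have d0 i : (0 < d i)%N by rewrite ltnW.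
have DB0 : (0 < \sum_(i < n | i != j) (d i).-1)%N.
  have [i ij] : exists i, i != j.
    case: (eqVneq j (Ordinal n1)) => [->|]; last by exists (Ordinal n1); rewrite eq_sym.
    by exists (Ordinal (ltnW n1)).
  by rewrite (bigD1 i) //=; have := hd i; lia.
have t0 : (0 < d j %/ p)%N by rewrite divn_gt0.
have eD : D = ((d j).-1 + \sum_(i < n | i != j) (d i).-1)%N by rewrite /socle_deg (bigD1 j).
have hm := ltn_pmod (d j) p0.
apply: (@centered_of_base j) => [|i x iDB [f hf ->]].
  by rewrite eD; move: hS pj; move: (\sum_(i < n | _) _)%N => S; lia.
rewrite -[\pi f]/(toA hd f) -rmorphXn -rmorphM => /toA_eq0 h; apply/toA_eq0.
apply: (@mixed_inj K p n d j (d j %/ p) hp (d j %% p) d0 (divn_eq _ _) t0 dp _ _ DB0 i) => //.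
  by move: hS; move: (\sum_(i < n | _) _)%N => S; lia.
by move: hS; move: (\sum_(i < n | _) _)%N => S; lia.
Qed.

Lemma centered_one : n = 1%N -> centered_lefschetz l.
Proof.
move=> n1; have i0 : 'I_n by rewrite n1; exact: ord0.
have all0 i : i = i0 by apply/val_inj; have := ltn_ord i; have := ltn_ord i0; rewrite /=; lia.
have DB0 : (\sum_(i < n | i != i0) (d i).-1)%N = 0%N.
  by rewrite big1 // => i; rewrite (all0 i) eqxx.
have eL : sum_var K n = 'X_i0.
  by rewrite /sum_var (bigD1 i0) //= big1 ?addr0 // => i; rewrite (all0 i) eqxx.
have eD : D = (d i0).-1 by rewrite /socle_deg (bigD1 i0) //= DB0 addn0.
apply: (@centered_of_base i0) => [|i x]; rewrite DB0 // leqn0 => /eqP-> [f hf ->].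
rewrite -[\pi f]/(toA hd f) -rmorphXn -rmorphM subn0 eL => /toA_eq0 h; apply/toA_eq0 => m md.
case: (eqVneq (mdeg m) 0%N) => [/eqP|]; last exact: dhomog_nemf_coeff.
rewrite mdeg_eq0 => /eqP->; rewrite -(mcoeffMX f (U_(i0) *+ D) 0) mulrC -mpolyXn; apply: h => t.
by rewrite addm0 mulmnE mnm1E (all0 t) eqxx mul1n eD prednK // ltnW.
Qed.

(** With d_a <= d_b, [centered_of_base] leaves only degrees i < min(d_a, d_b), where every element
    is a binary form and the determinant criterion applies. *)
Lemma centered_two p a b : n = 2%N -> a != b -> p \in [pchar K] ->
  pair_good p (d a) (d b) -> centered_lefschetz l.
Proof.
move=> n2; wlog dab : a b / (d a <= d b)%N => [W|] ab hp pg.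
  case: (leqP (d a) (d b)) => h; first exact: (W a b).
  by apply: (W b a); rewrite 1?eq_sym ?(ltnW h) //; apply: pair_goodC.
have cover i : i != b -> i = a.
  move=> ib; apply/val_inj; move: ib ab; rewrite -!(inj_eq val_inj) /=.
  by have := ltn_ord i; have := ltn_ord a; have := ltn_ord b; lia.
have sum2 (V : nmodType) (F : 'I_n -> V) : \sum_i F i = F a + F b.
  rewrite (bigD1 a) // (bigD1 b) 1?eq_sym //= big1 ?addr0 // => i /andP[ia ib].
  by case/eqP: ia; apply: cover.
have sumB (F : 'I_n -> nat) : (\sum_(i < n | i != b) F i = F a)%N.
  rewrite (big_pred1 a) // => i /=; apply/idP/eqP => [|->//]; exact: cover.
have eD : D = ((d a).-1 + (d b).-1)%N := sum2 nat (fun i => (d i).-1).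
pose z : A := toA hd 'X_a; pose y : A := toA hd 'X_b.
have el : l = z + y by rewrite /sum_var sum2 rmorphD.
have za : z ^+ d a * 1 = 0 by rewrite mulr1; exact: var_nilp.
have yb : y ^+ d b * 1 = 0 by rewrite mulr1; exact: var_nilp.
have monE u t i : (U_(a) *+ u + U_(b) *+ t)%MM i = ((a == i) * u + (b == i) * t)%N.
  by rewrite mnmDE !mulmnE !mnm1E.
have soc : z ^+ (d a).-1 * y ^+ (d b).-1 * 1 != 0.
  rewrite mulr1 /z /y -!rmorphXn -rmorphM /= !mpolyXn -mpolyXD; apply/eqP => /toA_eq0 h.
  case/eqP: (oner_neq0 K); rewrite -(h (U_(a) *+ (d a).-1 + U_(b) *+ (d b).-1)%MM).
    by rewrite mcoeffX eqxx.
  move=> i; rewrite monE; have := hd i.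
  case: (eqVneq i b) => [->|/cover->]; first by rewrite (negbTE ab); lia.
  by rewrite ?eqxx; lia.
have [da db] := (hd a, hd b).
apply: (@centered_of_base b) => [|i x]; rewrite sumB; first by rewrite eD; lia.
move=> ia [f hf ->]; rewrite -[\pi f]/(toA hd f).
have [e ->] : exists e : nat -> K, toA hd f =
    \sum_(u < i.+1) scalar hd (e u) * (z ^+ u * y ^+ (i - u) * 1).
  pose e u := f@_(U_(a) *+ u + U_(b) *+ (i - u)); exists e.
  have -> : f = \sum_(u < i.+1) e u *: 'X_[U_(a) *+ u + U_(b) *+ (i - u)].
    apply/mpolyP => m; rewrite raddf_sum /=.
    under eq_bigr do rewrite mcoeffZ mcoeffX.
    have em : m = (U_(a) *+ m a + U_(b) *+ m b)%MM.
      apply/mnmP => t; rewrite monE; case: (eqVneq t b) => [->|/cover->].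
        by rewrite ?eqxx (negbTE ab); lia.
      by rewrite ?eqxx; lia.
    have dm : mdeg m = (m a + m b)%N by rewrite mdegE; exact: (sum2 nat).
    have ne u : (u <= i)%N -> (U_(a) *+ u + U_(b) *+ (i - u))%MM = m -> u = m a /\ mdeg m = i.
      move=> ui <-; rewrite monE eqxx [b == a]eq_sym (negbTE ab) mdegD !mdegMn !mdeg1; lia.
    case: (eqVneq (mdeg m) i) => mi; last first.
      rewrite (dhomog_nemf_coeff hf mi) big1 // => u _; case: eqP => [eu|_]; rewrite ?mulr0 //.
      by have [_ /eqP] := ne u (ltn_ord u) eu; rewrite (negbTE mi).
    have ui : (m a < i.+1)%N by lia.
    rewrite (bigD1 (Ordinal ui)) //= big1 ?addr0 => [|u um].
      by rewrite /e -mi dm addKn -em eqxx mulr1.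
    case: eqP => [eu|_]; rewrite ?mulr0 //.
    have [eu' _] := ne u (ltn_ord u) eu.
    by case/eqP: um; apply/val_inj.
  rewrite rmorph_sum; apply: eq_bigr => u _ /=.
  by rewrite mulr1 /z /y -!rmorphXn -rmorphM /= !mpolyXn -mpolyXD toAZ.
have [c ->] := binary_form_span (scalar hd) z y 1 i e.
have iab : (i < minn (d a) (d b))%N by lia.
rewrite el eD => h.
rewrite (pair_good_lefschetz (phi := scalar hd) hp (ltnW da) (ltnW db) za yb soc pg iab (c := c)).
  by rewrite /binary_form big1 // => s _; rewrite mxE rmorph0 mul0r.
by rewrite -[RHS]h; congr (_ ^+ _ * _); lia.
Qed.

End Sufficiency.

(** * The classification *)

Lemma linear_formE (K : fieldType) n (d : 'I_n -> nat) (hd : forall i, (2 <= d i)%N)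
    (l : monomial_ci K hd) : monomial_ci_graded 1 l ->
  exists alpha : 'I_n -> K, l = \sum_i scalar hd (alpha i) * toA hd 'X_i.
Proof.
case=> f hf ->; exists (fun i => f@_U_(i)); rewrite -[\pi f]/(toA hd f).
have -> : f = \sum_i f@_U_(i) *: 'X_i.
  apply/mpolyP => m; rewrite raddf_sum /=.
  under eq_bigr do rewrite mcoeffZ mcoeffX.
  case: (boolP (mdeg m == 1%N)) => [/mdeg1P[i /eqP->]|m1].
    rewrite (bigD1 i) //= eqxx mulr1 big1 ?addr0 // => i' i'i.
    by rewrite eq_mnm1 (negbTE i'i) mulr0.
  rewrite (dhomog_nemf_coeff hf m1) big1 // => i _; case: eqP => [e|_]; last by rewrite mulr0.
  by rewrite -e mdeg1 in m1.
rewrite rmorph_sum; apply: eq_bigr => i _ /=; rewrite toAZ; congr (scalar hd _ * _).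
rewrite raddf_sum (bigD1 i) //= mcoeffZ mcoeffXU eqxx mulr1 big1 ?addr0 // => j ji.
by rewrite mcoeffZ mcoeffXU (negbTE ji) mulr0.
Qed.

Local Open Scope nat_scope.

Lemma half_digitE p x : odd p -> 2 < p ->
  (x %% p \in [:: (p - 1) %/ 2; (p + 1) %/ 2]) <-> half_residue p x.
Proof.
move=> op p2; rewrite !inE /half_residue.
have -> : (p - 1) %/ 2 = p./2 by lia.
have -> : (p + 1) %/ 2 = p./2.+1 by lia.
by split=> [/orP[]/eqP->|[->|->]]; rewrite ?eqxx ?orbT; [left|right| |].
Qed.

Lemma pair_good_two_parity a b : 1 < a -> 1 < b -> pair_good 2 a b -> odd a != odd b.
Proof.
wlog ab : a b / a <= b => [W|] a1 b1 h.
  case: (leqP a b) => ab; first exact: W.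
  by rewrite eq_sym; apply: W; rewrite ?(ltnW ab) //; apply: pair_goodC.
by case: ((pair_good_two a1 ab).1 h) => -[-> hb]; lia.
Qed.

Lemma digit0 p d k c : base_expansion p d k c -> c 0 = d %% p.
Proof. by move=> h; rewrite -(base_expansion_digit h (leq0n k)) divn1. Qed.

Lemma large_top_exponent p d k c : base_expansion p d k c -> (p <= d) = (0 < k).
Proof.
move=> h; have [_ h1 h2] := base_expansion_top h.
have p0 : 0 < p by case: h => h _ _; have := h 0 isT; lia.
case: k h1 h2 {h} => [|k] h1 h2; first by rewrite expn1 in h2; lia.
by rewrite (leq_trans _ h1) // -{1}[p]expn1 leq_pexp2l.
Qed.

Lemma pair_good_digitsP p a b ka kb ca cb : odd p -> 2 < p ->
  base_expansion p a ka ca -> base_expansion p b kb cb -> 0 < ka <= kb ->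
  pair_good p a b <->
  [/\ ca 0 \in [:: (p - 1) %/ 2; (p + 1) %/ 2] /\ cb 0 \in [:: (p - 1) %/ 2; (p + 1) %/ 2],
      forall j, 1 <= j <= ka - 1 -> ca j = (p - 1) %/ 2 /\ cb j = (p - 1) %/ 2 &
      ca ka + cb ka < p /\ (ka < kb -> ca ka <= cb ka)].
Proof.
move=> op p2 ha hb /andP[ka0 kab]; have p1 : 1 < p by lia.
have [ta la ua] := base_expansion_top ha; have [tb lb ub] := base_expansion_top hb.
have dig_a := base_expansion_digit ha; have dig_b := base_expansion_digit hb.
have lka : p ^ ka <= b by apply: leq_trans lb; rewrite leq_pexp2l // ltnW.
have lua : p ^ ka <= a < p ^ ka.+1 by rewrite la.
have hp2 : (p - 1) %/ 2 = p./2 by lia.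
have xa := half_digitE a op p2; have xb := half_digitE b op p2.
rewrite (digit0 ha) (digit0 hb) -ta -(dig_b ka kab).
have big : (ka < kb) = (p ^ ka.+1 <= b).
  apply/idP/idP => h; first by apply: leq_trans lb; rewrite leq_pexp2l // ltnW.
  rewrite ltnNge; apply: contraTN h => h; rewrite -ltnNge (leq_trans ub) //.
  by rewrite leq_pexp2l // ltnW.
split=> [h|[[/xa ra /xb rb] hj [hs ht]]].
  have [hh hs ht] := pair_good_digits op p2 lua lka ka0 h.
  have [ra ja] := (half_residues_digits a op p2 ka0).1 (fun e he => (hh e he).1).
  have [rb jb] := (half_residues_digits b op p2 ka0).1 (fun e he => (hh e he).2).
  split; [by split; [apply/xa|apply/xb]| |by rewrite big].
  move=> j jk; rewrite hp2; have jk' : 0 < j < ka by lia.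
  rewrite -dig_a -?dig_b ?ja ?jb //; lia.
have ja := (half_residues_digits a op p2 ka0).2; have jb := (half_residues_digits b op p2 ka0).2.
rewrite hp2 in hj; have hh e : 0 < e <= ka -> half_residue (p ^ e) a /\ half_residue (p ^ e) b.
  move=> he; split.
    apply: ja => //; split=> // j jk; have jk' : 1 <= j <= ka - 1 by lia.
    by rewrite dig_a; [have [] := hj j jk'|lia].
  apply: jb => //; split=> // j jk; have jk' : 1 <= j <= ka - 1 by lia.
  by rewrite dig_b; [have [] := hj j jk'|lia].
by apply: (pair_good_of_digits op p2 lua lka ka0 hh hs); rewrite -big.
Qed.

Lemma two_digitsP b k c : 1 < b -> base_expansion 2 b k c ->
  (odd b <-> c 0 = 1) /\ (2 < b -> (b %% 4 = 2 <-> c 1 = 1 /\ c 0 = 0)).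
Proof.
move=> b1 h; have c0 := digit0 h; split; first by rewrite c0 modn2; case: (odd b).
move=> b2; have k0 : 0 < k by rewrite -(large_top_exponent h) ltnW.
rewrite -(base_expansion_digit h k0) c0 expn1; lia.
Qed.

Theorem theorem3p4 (K : fieldType) (p : nat) (hp : p \in [pchar K]%R)
    (n : nat) (hn : 1 <= n) (d : 'I_n -> nat) (hd : forall i, 2 <= d i)
    (k : 'I_n -> nat) (c : 'I_n -> nat -> nat)
    (hc : forall i, base_expansion p (d i) (k i) (c i)) :
  strong_lefschetz (monomial_ci_graded (K := K) (hd := hd)) <->
  n = 1
  \/ (n = 2 /\ p = 2 /\ exists a b : 'I_n, a != b /\ d a <= d b /\
        ((d a = 2 /\ c b 0 = 1) \/
         (d a = 3 /\ c b 1 = 1 /\ c b 0 = 0)))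
  \/ (n = 2 /\ 2 < p /\ exists a b : 'I_n, a != b /\ k a <= k b /\
        (c a 0 \in [:: (p - 1) %/ 2; (p + 1) %/ 2] /\
         c b 0 \in [:: (p - 1) %/ 2; (p + 1) %/ 2]) /\
        (forall j, 1 <= j <= k a - 1 ->
           c a j = (p - 1) %/ 2 /\ c b j = (p - 1) %/ 2) /\
        (c a (k a) + c b (k a) < p /\
         (k a < k b -> c a (k a) <= c b (k a))))
  \/ (2 <= n /\ \sum_(i < n) (d i - 1) < p)
  \/ (2 <= n /\ exists j : 'I_n, p <= d j /\
        (forall i, i != j -> d i < p) /\
        \sum_(i < n | i != j) (d i - 1) <= minn (c j 0) (p - c j 0)).
Proof.
have pp := pcharf_prime hp; have p1 := prime_gt1 pp.
have pred_sum (P : pred 'I_n) : \sum_(i < n | P i) (d i - 1) = \sum_(i < n | P i) (d i).-1.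
  by apply: eq_bigr => i _; rewrite subn1.
have odd_p : p != 2 -> odd p /\ 2 < p.
  by move=> p2; have [e|op] := even_prime pp; [rewrite e in p2|split=> //; lia].
split=> [/strong_lefschetz_centered[l l1 cl]|].
- have [alpha el] := linear_formE l1; rewrite el in cl => {l l1 el}.
  have [n1|n2] : n = 1 \/ 2 <= n by lia.
    by left.
  right.
  have pg := pair_good_distinct hp cl.
  pose i0 : 'I_n := Ordinal (ltnW n2); pose i1 : 'I_n := Ordinal n2.
  have i01 : i0 != i1 by [].
  have third : 2 < n -> forall a b : 'I_n, a != b -> exists2 t, a != t & b != t.
    move=> n3 a b ab; case: (pickP [pred t | (a != t) && (b != t)]) => [t /andP[]|none].
      by exists t.
    have : #|[set: 'I_n]| <= #|[set a; b]|.
      apply/subset_leq_card/subsetP => t _; have := none t.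
      by rewrite !inE /= ![_ == t]eq_sym; case: (t == a) => //= /negbFE.
    by rewrite cardsT card_ord cards2 ab leqNgt n3.
  case: (eqVneq p 2) => [p2|/odd_p[op p2]].
    subst p; left.
    have en : n = 2.
      (* Among three exponents two have equal parity, which contradicts [pair_good_two_parity]. *)
      apply/eqP; rewrite eqn_leq n2 andbT leqNgt; apply/negP => n3.
      have [t t0 t1] := third n3 _ _ i01.
      have par i j : i != j -> odd (d i) != odd (d j).
        by move=> ij; apply: pair_good_two_parity => //; apply: pg.
      by have := par _ _ i01; have := par _ _ t0; have := par _ _ t1;
         case: (odd _); case: (odd _); case: (odd _).
    split=> //; split=> //.
    have [a [b [ab dab]]] : exists a b : 'I_n, a != b /\ d a <= d b.
      by case: (leqP (d i0) (d i1)) => h; [exists i0, i1|exists i1, i0; rewrite ltnW].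
    exists a, b; split=> //; split=> //.
    have [o m4] := two_digitsP (hd b) (hc b).
    case: ((pair_good_two (hd a) dab).1 (pg _ _ ab)) => -[ea eb].
      by left; split=> //; apply/o.
    by right; split=> //; apply/m4 => //; lia.
  right; case: (boolP [exists a, [exists b, [&& a != b, p <= d a & p <= d b]]]).
    case/existsP => a /existsP[b /and3P[ab pa pb]]; left.
    have en : n = 2.
      apply/eqP; rewrite eqn_leq n2 andbT leqNgt; apply/negP => n3.
      have [t ta tb] := third n3 _ _ ab.
      exact: (no_large_triple hp cl p2 ab ta tb pa pb).
    split=> //; split=> //.
    have [a' [b' [ab' kab pa']]] : exists a b : 'I_n, [/\ a != b, k a <= k b & p <= d a].
      by case: (leqP (k a) (k b)) => h; [exists a, b|exists b, a; rewrite eq_sym ltnW].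
    exists a', b'; split=> //; split=> //.
    have ka0 : 0 < k a' <= k b' by rewrite kab -(large_top_exponent (hc a')) pa'.
    by have [] := (pair_good_digitsP op p2 (hc a') (hc b') ka0).1 (pg _ _ ab').
  rewrite negb_exists => /forallP no2; right.
  case: (boolP [exists j, p <= d j]) => [/existsP[j pj]|].
    right; split=> //; exists j; split=> //.
    have small i : i != j -> d i < p.
      move=> ij; have := no2 i; rewrite negb_exists => /forallP/(_ j).
      by rewrite ij pj andbT /= -ltnNge.
    split=> //; rewrite pred_sum (digit0 (hc j)).
    have eS : \sum_(i in ~: [set j]) (d i).-1 = \sum_(i < n | i != j) (d i).-1.
      by apply: eq_bigl => i; rewrite !inE.
    have lt : \sum_(i < n | i != j) (d i).-1 < p.
      by rewrite -eS; apply: (sum_small_lt hp cl) => i; rewrite !inE => /small/ltnW.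
    have gt : 0 < \sum_(i < n | i != j) (d i).-1.
      have [i ij] : exists i, i != j.
        by case: (eqVneq i0 j) => [e|]; [exists i1; rewrite -e eq_sym|exists i0].
      by rewrite (bigD1 i) //=; have := hd i; lia.
    have := @pair_good_mixed p (\sum_(i < n | i != j) (d i).-1).+1 (d j) p1.
    rewrite subn1 /=; apply; rewrite ?ltnS ?gt ?lt //; first exact: leq_trans pj.
    by rewrite -eS; apply: (pair_good_set hp cl); rewrite !inE eqxx.
  rewrite negb_exists => /forallP small; left; split=> //; rewrite pred_sum.
  have := sum_small_lt hp cl (S := setT).
  by rewrite (eq_bigl predT) => [|i]; [apply=> i _; have := small i; lia|rewrite inE].
- move=> H; have [n1|n1] := eqVneq n 1.
    exact: (centered_strong_lefschetz (deg_sum_var K hd) (@centered_one K n d hd n1)).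
  apply: (centered_strong_lefschetz (deg_sum_var K hd)).
  case: H => [e|H]; first by rewrite e eqxx in n1.
  case: H => [[n2 [p2 [a [b [ab [dab h]]]]]]|].
    apply: (@centered_two K n d hd p a b n2 ab hp); subst p; apply/(pair_good_two (hd a) dab).
    have [o m4] := two_digitsP (hd b) (hc b).
    case: h => -[ea eb]; [left|right]; split=> //; first exact/o.
    by apply/m4 => //; lia.
  case=> [[n2 [p2 [a [b [ab [kab [h0 [hj hs]]]]]]]]|].
    apply: (@centered_two K n d hd p a b n2 ab hp); have [op _] : odd p /\ 2 < p by apply: odd_p; lia.
    (* If k_a = 0, then d_a is its own leading digit, and the conditions reduce to the bound on d_a
       + d_b or to the residue condition on d_b. *)
    have [ka0|ka0] := posnP (k a); last first.
      by apply/(pair_good_digitsP op p2 (hc a) (hc b)); rewrite ?ka0.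
    have [ta _ ua] := base_expansion_top (hc a); rewrite ka0 in ta ua hs.
    rewrite divn1 in ta; rewrite -ta in hs; case: hs => hs ht.
    have [kb0|kb0] := posnP (k b).
      have [tb _ _] := base_expansion_top (hc b); rewrite kb0 divn1 in tb.
      by apply: pair_good_of_sum => //; rewrite -tb in hs; lia.
    apply: pair_good_of_residue => //; rewrite -(digit0 (hc b)).
    by have := ht kb0; lia.
  case=> [[n2 hs]|[n2 [j [pj [small hs]]]]].
    by apply: (@centered_small_socle K n d hd p hp); rewrite /socle_deg -pred_sum.
  apply: (@centered_mixed K n d hd p j hp n2 pj small).
  by rewrite -pred_sum -(digit0 (hc j)).
Qed.
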